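(* The restriction of $\Phi:Sp_{2g}(k)\to W(k)/I^2$ to the subgroup $\mathrm{Stab}_L$ is a group homomorphism with values in $I/I^2$, and it factors through the canonical projection $\mathrm{Stab}_L \rightarrow GL_g(k)$, $\begin{pmatrix} x & u\\ 0& {}^tx^{-1}\end{pmatrix}\mapsto x$; more precisely, $$\Phi\begin{pmatrix} x & u \\ 0 & {}^tx^{-1}\end{pmatrix} =\langle 1,-\det x\rangle \in I/I^2 = k^\times/(k^\times)^2 .$$
   Context: $k$ is a field of characteristic different from $2$, $g\ge1$, $L=k^g$, $H(L)=L\oplus L^*$ with symplectic form $\omega((x,\xi),(y,\eta))=\xi(y)-\eta(x)$ and isometry group $Sp_{2g}(k)$. $W(k)$ is the Witt ring of symmetric bilinear forms over $k$, $I=\ker(W(k)\to\mathbb{Z}/2)$ (rank mod 2) its fundamental ideal; the class in $W(k)$ of a possibly degenerate form $(P,q)$ is the class of the induced form on $P/\ker q$. $\langle a,b\rangle$ denotes the diagonal form, and $I/I^2$ is identified with $k^\times/(k^\times)^2$ by the discriminant $q\mapsto(-1)^{r(r-1)/2}\det q$ ($r$ the rank of $q$). $\mathrm{Stab}_L\subset Sp_{2g}(k)$ is the subgroup of elements mapping $L$ to itself; in blocks for $L\oplus L^*$ they are the symplectic matrices of the form $\begin{pmatrix} x & u\\ 0&{}^tx^{-1}\end{pmatrix}$ with $x\in GL_g(k)$. Write $L_j=L$ for $j$ even and $L_j=L^*$ for $j$ odd (with $L^{**}=L$). For a symmetric map $q:L\to L^*$ put $E(q)=\begin{pmatrix}1&0\\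 q&1\end{pmatrix}$, and for a symmetric map $q:L^*\to L$ put $E(q)=\begin{pmatrix}1&q\\ 0&1\end{pmatrix}$. The former matrices form the group $\mathcal{S}_{L^*}$, the latter the group $\mathcal{S}_L$. Let $E:\mathcal{S}_L*\mathcal{S}_{L^*}\to Sp_{2g}(k)$ be the evaluation homomorphism from the free product; it is surjective. A Sturm sequence is a sequence $(q_m,\dots,q_n)$ of symmetric maps $q_j:L_j\to L_{j+1}$ (zero allowed); it represents the product $q_m\cdots q_n$ in $\mathcal{S}_L*\mathcal{S}_{L^*}$. It is of type $00$ if $m,n$ are even. Its Sylvester matrix is the symmetric bilinear form with support $L_m\oplus\dots\oplus L_n$ given by the block tridiagonal matrix with diagonal blocks $(-1)^jq_j$ and all blocks immediately above and below the diagonal equal to the identity. For $w\in\mathcal{S}_L*\mathcal{S}_{L^*}$, $f_{00}(w)\in W(k)$ is the class of the Sylvester matrix of any type $00$ Sturm sequence representing $w$ (independent of the representative). Finally $\Phi(x)=f_{00}(\tilde x)\bmod I^2$ for any $\tilde x\in\mathcal{S}_L*\mathcal{S}_{L^*}$ with $E(\tilde x)=x$; this is independent of $\tilde x$. *)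

(* Defs.v *)
From HB Require Import structures.
From mathcomp Require Import all_boot all_order all_algebra.
From mathcomp Require Import mxtens ring_quotient.
From mathcomp Require Import boolp classical_sets.

Set Implicit Arguments.
Unset Strict Implicit.
Unset Printing Implicit Defensive.

Import GRing.Theory.

Local Open Scope ring_scope.
Local Open Scope quotient_scope.

(* A Gram matrix A : 'M_n stands for the bilinear form (u, v) |-> u A v^T on
   row vectors.  Stating isometry with a two-sided inverse allows the two
   sizes to be only propositionally equal. *)
Section Isometry.
Variable k : fieldType.

Definition isometric n m (A : 'M[k]_n) (B : 'M[k]_m) : Prop :=
  exists (P : 'M_(n, m)) (Q : 'M_(m, n)),
    [/\ P *m Q = 1%:M, Q *m P = 1%:M & P *m B *m P^T = A].

Definition osum n m (A : 'M[k]_n) (B : 'M[k]_m) : 'M[k]_(n + m) :=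
  block_mx A 0 0 B.

(* Metabolic (split) forms are the nondegenerate forms having a Lagrangian.
   In characteristic different from 2 they are the hyperbolic forms. *)
Definition metab m (D : 'M[k]_m) : 'M[k]_(m + m) := block_mx 0 1%:M 1%:M D.

Definition metabolic n (X : 'M[k]_n) : Prop :=
  exists m (D : 'M[k]_m), D^T = D /\ isometric X (metab D).

Definition witt_rel n m (A : 'M[k]_n) (B : 'M[k]_m) : Prop :=
  exists p q (X : 'M[k]_p) (Y : 'M[k]_q),
    [/\ metabolic X, metabolic Y & isometric (osum A X) (osum B Y)].

Lemma isom_refl n (A : 'M[k]_n) : isometric A A.
Proof. by exists 1%:M, 1%:M; rewrite !mul1mx trmx1 mulmx1. Qed.

Lemma isom_sym n m (A : 'M[k]_n) (B : 'M[k]_m) :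
  isometric A B -> isometric B A.
Proof.
case=> P [Q [PQ QP <-]]; exists Q, P; split=> //.
by rewrite !mulmxA QP mul1mx -mulmxA -trmx_mul QP trmx1 mulmx1.
Qed.

Lemma isom_trans n m p (A : 'M[k]_n) (B : 'M[k]_m) (C : 'M[k]_p) :
  isometric A B -> isometric B C -> isometric A C.
Proof.
case=> P [Q [PQ QP <-]] [P' [Q' [PQ' QP' <-]]].
exists (P *m P'), (Q' *m Q); split.
- by rewrite mulmxA -(mulmxA P) PQ' mulmx1.
- by rewrite mulmxA -(mulmxA Q') QP mulmx1.
- by rewrite trmx_mul !mulmxA.
Qed.

Lemma isom_dim n m (A : 'M[k]_n) (B : 'M[k]_m) : isometric A B -> n = m.
Proof.
suff H n' m' (P : 'M[k]_(n', m')) Q : P *m Q = 1%:M -> (n' <= m')%N.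
  by case=> P [Q [PQ QP _]]; apply/eqP; rewrite eqn_leq (H _ _ _ _ PQ) (H _ _ _ _ QP).
move=> PQ; rewrite -(mxrank1 k n') -PQ.
exact: leq_trans (mxrankM_maxl _ _) (rank_leq_col _).
Qed.

Lemma isom_osum n m p q (A : 'M[k]_n) (B : 'M[k]_m) (C : 'M[k]_p) (D : 'M[k]_q) :
  isometric A B -> isometric C D -> isometric (osum A C) (osum B D).
Proof.
case=> P [Q [PQ QP <-]] [P' [Q' [PQ' QP' <-]]].
exists (block_mx P 0 0 P'), (block_mx Q 0 0 Q').
rewrite /osum tr_block_mx !mulmx_block !trmx0.
by rewrite !(mulmx0, mul0mx, addr0, add0r) PQ QP PQ' QP' -!scalar_mx_block.
Qed.

Lemma isom_opp n m (A : 'M[k]_n) (B : 'M[k]_m) :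
  isometric A B -> isometric (- A) (- B).
Proof.
by case=> P [Q [PQ QP <-]]; exists P, Q; split; rewrite // mulmxN mulNmx.
Qed.

Lemma tens11 a b : (1%:M : 'M[k]_a) *t (1%:M : 'M[k]_b) = 1%:M.
Proof.
apply/matrixP=> i j.
case: (mxtens_indexP i)=> i0 i1; case: (mxtens_indexP j)=> j0 j1.
rewrite tensmxE !mxE -natrM mulnb (can_eq (@mxtens_indexK _ _)).
by rewrite xpair_eqE.
Qed.

Lemma isom_tens n m p q (A : 'M[k]_n) (B : 'M[k]_m) (C : 'M[k]_p) (D : 'M[k]_q) :
  isometric A B -> isometric C D -> isometric (A *t C) (B *t D).
Proof.
case=> P [Q [PQ QP <-]] [P' [Q' [PQ' QP' <-]]].
by exists (P *t P'), (Q *t Q'); split;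
  rewrite ?trmx_tens !tensmx_mul ?PQ ?QP ?PQ' ?QP' ?tens11.
Qed.

Lemma isom_reindex n m (A : 'M[k]_n) (B : 'M[k]_m) (f : 'I_n -> 'I_m) f' :
  cancel f f' -> cancel f' f -> (forall i j, A i j = B (f i) (f j)) ->
  isometric A B.
Proof.
move=> fK f'K AB; exists (\matrix_(i, j) (f i == j)%:R).
exists (\matrix_(i, j) (f' i == j)%:R); split; apply/matrixP=> i j; rewrite !mxE.
- rewrite (bigD1 (f i)) //= !mxE eqxx fK mul1r big1 ?addr0 // => x nx.
  by rewrite mxE eq_sym (negPf nx) mul0r.
- rewrite (bigD1 (f' i)) //= !mxE eqxx f'K mul1r big1 ?addr0 // => x nx.
  by rewrite mxE eq_sym (negPf nx) mul0r.
- rewrite (bigD1 (f j)) //= [X in _ + X]big1 => [|x nx]; last first.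
    by rewrite [X in _ * X]mxE mxE eq_sym (negPf nx) mulr0.
  rewrite !mxE eqxx mulr1 addr0 (bigD1 (f i)) //= !mxE eqxx mul1r AB.
  by rewrite big1 ?addr0 // => x nx; rewrite mxE eq_sym (negPf nx) mul0r.
Qed.

Lemma isom_cast n m (e1 e2 : n = m) (A : 'M[k]_n) :
  isometric (castmx (e1, e2) A) A.
Proof.
by rewrite (eq_irrelevance e2 e1); case: m / e1 {e2}; apply: isom_refl.
Qed.

Lemma isom_osumC n m (A : 'M[k]_n) (B : 'M[k]_m) :
  isometric (osum A B) (osum B A).
Proof.
exists (block_mx 0 1%:M 1%:M 0), (block_mx 0 1%:M 1%:M 0).
rewrite /osum tr_block_mx !mulmx_block !trmx0 !trmx1.
by rewrite !(mulmx0, mul0mx, addr0, add0r, mulmx1, mul1mx) -!scalar_mx_block.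
Qed.

Lemma isom_osumA n m p (A : 'M[k]_n) (B : 'M[k]_m) (C : 'M[k]_p) :
  isometric (osum A (osum B C)) (osum (osum A B) C).
Proof.
have := block_mxA (A11 := A) (A12 := 0) (A13 := 0) (A21 := 0) (A22 := B)
  (A23 := 0) (A31 := 0) (A32 := 0) (A33 := C).
rewrite /= !row_mx0 !col_mx0 => E; rewrite /osum E; exact: isom_cast.
Qed.

Lemma isom_osum0 m (Z : 'M[k]_0) (A : 'M[k]_m) : isometric (osum Z A) A.
Proof.
exists (col_mx 0 1%:M), (row_mx 0 1%:M).
rewrite mul_col_row mul_row_col !(mul0mx, mulmx0, mul1mx, add0r).
split=> //.
  by rewrite [RHS]scalar_mx_block; congr (block_mx _ _ _ _); rewrite ?flatmx0 ?thinmx0.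
rewrite tr_col_mx trmx0 trmx1 mul_col_mx mul0mx mul1mx mul_col_row.
rewrite !(mulmx0, mul0mx, mulmx1).
by congr (block_mx _ _ _ _); rewrite ?flatmx0 ?thinmx0.
Qed.

Lemma isom_osumACA n m p q (A : 'M[k]_n) (B : 'M[k]_m) (C : 'M[k]_p) (D : 'M[k]_q) :
  isometric (osum (osum A B) (osum C D)) (osum (osum A C) (osum B D)).
Proof.
apply: isom_trans (isom_osumA _ _ _) _.
apply: isom_trans (isom_sym (isom_osumA _ _ _)).
apply: isom_osum (isom_refl _).
apply: isom_trans (isom_sym (isom_osumA _ _ _)) _.
apply: isom_trans (isom_osumA _ _ _).
exact: isom_osum (isom_refl _) (isom_osumC _ _).
Qed.

Lemma isom_tensC n m (A : 'M[k]_n) (B : 'M[k]_m) :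
  isometric (A *t B) (B *t A).
Proof.
pose f a b (i : 'I_(a * b)) : 'I_(b * a) :=
  mxtens_index ((mxtens_unindex i).2, (mxtens_unindex i).1).
have fK a b : cancel (@f a b) (@f b a).
  by move=> i; case: (mxtens_indexP i) => x y; rewrite /f !mxtens_indexK.
apply: (isom_reindex (fK _ _) (fK _ _)) => i j.
by rewrite tensmxE mxE mulrC.
Qed.

Lemma isom_tensA n m p (A : 'M[k]_n) (B : 'M[k]_m) (C : 'M[k]_p) :
  isometric (A *t (B *t C)) ((A *t B) *t C).
Proof.
pose f (i : 'I_(n * (m * p))) : 'I_((n * m) * p) :=
  let u := mxtens_unindex i in let v := mxtens_unindex u.2 in
  mxtens_index (mxtens_index (u.1, v.1), v.2).
pose f' (i : 'I_((n * m) * p)) : 'I_(n * (m * p)) :=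
  let u := mxtens_unindex i in let v := mxtens_unindex u.1 in
  mxtens_index (v.1, mxtens_index (v.2, u.2)).
have fK : cancel f f'.
  move=> i; case: (mxtens_indexP i) => a b; case: (mxtens_indexP b) => c d.
  by rewrite /f /f' !mxtens_indexK.
have f'K : cancel f' f.
  move=> i; case: (mxtens_indexP i) => a b; case: (mxtens_indexP a) => c d.
  by rewrite /f /f' !mxtens_indexK.
apply: (isom_reindex fK f'K) => i j.
by rewrite !tensmxE !mxE mulrA.
Qed.

Lemma isom_tens1 n (A : 'M[k]_n) : isometric ((1%:M : 'M[k]_1) *t A) A.
Proof. by rewrite tens_scalar1mx; apply: isom_cast. Qed.

Lemma isom_tens_block n m p (A : 'M[k]_n) B C (D : 'M[k]_m) (E : 'M[k]_p) :
  isometric (block_mx A B C D *t E)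
            (block_mx (A *t E) (B *t E) (C *t E) (D *t E)).
Proof.
pose f (i : 'I_((n + m) * p)) : 'I_(n * p + m * p) :=
  let u := mxtens_unindex i in
  match split u.1 with
  | inl a => lshift _ (mxtens_index (a, u.2))
  | inr a => rshift _ (mxtens_index (a, u.2))
  end.
pose f' (i : 'I_(n * p + m * p)) : 'I_((n + m) * p) :=
  match split i with
  | inl a => mxtens_index (lshift _ (mxtens_unindex a).1, (mxtens_unindex a).2)
  | inr a => mxtens_index (rshift _ (mxtens_unindex a).1, (mxtens_unindex a).2)
  end.
have sl a b (x : 'I_a) : split (lshift b x) = inl x by rewrite (unsplitK (inl x)).
have sr a b (x : 'I_b) : split (rshift a x) = inr x by rewrite (unsplitK (inr x)).
have fl a b : f (mxtens_index (lshift _ a, b)) = lshift _ (mxtens_index (a, b)).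
  by rewrite /f mxtens_indexK sl.
have fr a b : f (mxtens_index (rshift _ a, b)) = rshift _ (mxtens_index (a, b)).
  by rewrite /f mxtens_indexK sr.
have f'l a b : f' (lshift _ (mxtens_index (a, b))) = mxtens_index (lshift _ a, b).
  by rewrite /f' sl mxtens_indexK.
have f'r a b : f' (rshift _ (mxtens_index (a, b))) = mxtens_index (rshift _ a, b).
  by rewrite /f' sr mxtens_indexK.
have fK : cancel f f'.
  move=> i; case: (mxtens_indexP i) => a b.
  by case: (split_ordP a) => x ->; rewrite ?fl ?fr ?f'l ?f'r.
have f'K : cancel f' f.
  move=> i; case: (split_ordP i) => x ->; case: (mxtens_indexP x) => a b;
  by rewrite ?f'l ?f'r ?fl ?fr.
apply: (isom_reindex fK f'K) => i j.
case: (mxtens_indexP i) => a b; case: (mxtens_indexP j) => c d.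
rewrite tensmxE; case: (split_ordP a) => x ->; case: (split_ordP c) => y ->;
  rewrite ?fl ?fr (block_mxEul, block_mxEur, block_mxEdl, block_mxEdr);
  by rewrite (block_mxEul, block_mxEur, block_mxEdl, block_mxEdr) tensmxE.
Qed.

Lemma isom_tensDl n m p (A : 'M[k]_n) (B : 'M[k]_m) (C : 'M[k]_p) :
  isometric (osum A B *t C) (osum (A *t C) (B *t C)).
Proof. by have := isom_tens_block A 0 0 B C; rewrite !tens0mx. Qed.

Lemma metabolic_isom n m (X : 'M[k]_n) (Y : 'M[k]_m) :
  isometric X Y -> metabolic Y -> metabolic X.
Proof.
by move=> XY [p [D [sD YD]]]; exists p, D; split=> //; apply: isom_trans YD.
Qed.

Lemma metabolic0 (Z : 'M[k]_0) : metabolic Z.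
Proof.
exists 0, 0; rewrite trmx0; split=> //.
by rewrite [Z]flatmx0 [metab 0]flatmx0; apply: isom_refl.
Qed.

Lemma metabolicD n m (X : 'M[k]_n) (Y : 'M[k]_m) :
  metabolic X -> metabolic Y -> metabolic (osum X Y).
Proof.
case=> p [D [sD XD]] [q [E [sE YE]]].
exists (p + q)%N, (osum D E); split.
  by rewrite /osum tr_block_mx sD sE !trmx0.
apply: isom_trans (isom_osum XD YE) _.
pose P : 'M[k]_((p + p) + (q + q), (p + q) + (p + q)) :=
  block_mx (block_mx 1%:M 0 0 0) (block_mx 0 0 1%:M 0)
           (block_mx 0 1%:M 0 0) (block_mx 0 0 0 1%:M).
exists P, P^T.
have PP : P *m P^T = 1%:M.
  rewrite /P !tr_block_mx !trmx0 !trmx1 !mulmx_block.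
  rewrite !(mulmx0, mul0mx, addr0, add0r, mulmx1, mul1mx).
  rewrite !add_block_mx !(addr0, add0r).
  by rewrite !block_mx0 -!scalar_mx_block.
have PP' : P^T *m P = 1%:M.
  rewrite /P !tr_block_mx !trmx0 !trmx1 !mulmx_block.
  rewrite !(mulmx0, mul0mx, addr0, add0r, mulmx1, mul1mx).
  rewrite !add_block_mx !(addr0, add0r).
  by rewrite !block_mx0 -!scalar_mx_block.
split=> //.
rewrite /P /osum /metab !tr_block_mx !trmx0 !trmx1.
rewrite [(1%:M : 'M_(p + q))]scalar_mx_block -(block_mx0 k p q p q).
rewrite !mulmx_block.
rewrite !(mulmx0, mul0mx, addr0, add0r, mulmx1, mul1mx).
rewrite !add_block_mx !(addr0, add0r) !mulmx_block.
rewrite !(mulmx0, mul0mx, addr0, add0r, mulmx1, mul1mx).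
by rewrite !add_block_mx !(addr0, add0r) !block_mx0.
Qed.

Lemma metabolic_tens n m (X : 'M[k]_n) (B : 'M[k]_m) :
  metabolic X -> B^T = B -> B \in unitmx -> metabolic (X *t B).
Proof.
case=> p [D [sD XD]] sB uB.
apply: (metabolic_isom (isom_tens XD (isom_refl B))).
apply: (metabolic_isom (isom_tens_block _ _ _ _ _)).
rewrite tens0mx.
set C := 1%:M *t B; set C' := (1%:M : 'M[k]_p) *t invmx B.
have CC' : C *m C' = 1%:M by rewrite tensmx_mul mul1mx mulmxV ?tens11.
have C'C : C' *m C = 1%:M by rewrite tensmx_mul mul1mx mulVmx ?tens11.
have sC : C^T = C by rewrite trmx_tens trmx1 sB.
have sC' : C'^T = C' by rewrite trmx_tens trmx1 trmx_inv sB.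
exists (p * m)%N, (C' *m (D *t B) *m C'); split.
  by rewrite !trmx_mul sC' trmx_tens sD sB mulmxA.
exists (block_mx 1%:M 0 0 C), (block_mx 1%:M 0 0 C').
rewrite tr_block_mx !mulmx_block !trmx0 trmx1 sC.
rewrite !(mulmx0, mul0mx, addr0, add0r, mulmx1, mul1mx).
rewrite CC' C'C -!scalar_mx_block; split=> //.
by rewrite !mulmxA CC' mul1mx -mulmxA C'C mulmx1.
Qed.

Lemma metabolicN n (A : 'M[k]_n) :
  A^T = A -> A \in unitmx -> metabolic (osum A (- A)).
Proof.
move=> sA uA; exists n, (invmx A); rewrite trmx_inv sA; split=> //.
apply: isom_sym.
exists (block_mx 1%:M 1%:M (invmx A) 0), (block_mx 0 A 1%:M (- A)).
rewrite /osum /metab tr_block_mx !mulmx_block trmx0 trmx1 trmx_inv sA.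
rewrite !(mulmx0, mul0mx, addr0, add0r, mulmx1, mul1mx).
by rewrite mulNmx mulmxV // mulVmx // !subrr mul1mx -!scalar_mx_block.
Qed.

Lemma isom_witt n m (A : 'M[k]_n) (B : 'M[k]_m) :
  isometric A B -> witt_rel A B.
Proof.
move=> AB; exists 0, 0, 0, 0; split; try exact: metabolic0.
exact: isom_osum AB (isom_refl _).
Qed.

Lemma witt_sym n m (A : 'M[k]_n) (B : 'M[k]_m) : witt_rel A B -> witt_rel B A.
Proof. by case=> p [q [X [Y [mX mY /isom_sym h]]]]; exists q, p, Y, X. Qed.

Lemma witt_trans n m p (A : 'M[k]_n) (B : 'M[k]_m) (C : 'M[k]_p) :
  witt_rel A B -> witt_rel B C -> witt_rel A C.
Proof.
case=> a [b [X [Y [mX mY h]]]] [c [d [Z [T [mZ mT h']]]]].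
exists (a + c)%N, (d + b)%N, (osum X Z), (osum T Y).
split; try exact: metabolicD.
apply: isom_trans (isom_osumA _ _ _) _.
apply: isom_trans (isom_osum h (isom_refl _)) _.
apply: isom_trans (isom_sym (isom_osumA _ _ _)) _.
apply: isom_trans (isom_osum (isom_refl _) (isom_osumC _ _)) _.
apply: isom_trans (isom_osumA _ _ _) _.
apply: isom_trans (isom_osum h' (isom_refl _)) _.
exact: isom_sym (isom_osumA _ _ _).
Qed.

Lemma witt_osum n m p q (A : 'M[k]_n) (B : 'M[k]_m) (C : 'M[k]_p) (D : 'M[k]_q) :
  witt_rel A B -> witt_rel C D -> witt_rel (osum A C) (osum B D).
Proof.
case=> a [b [X [Y [mX mY h]]]] [c [d [Z [T [mZ mT h']]]]].
exists (a + c)%N, (b + d)%N, (osum X Z), (osum Y T).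
split; try exact: metabolicD.
apply: isom_trans (isom_osumACA _ _ _ _) _.
apply: isom_trans (isom_osum h h') _.
exact: isom_osumACA.
Qed.

Lemma witt_tensl n m p (A : 'M[k]_n) (B : 'M[k]_m) (C : 'M[k]_p) :
  C^T = C -> C \in unitmx -> witt_rel A B -> witt_rel (A *t C) (B *t C).
Proof.
move=> sC uC [a [b [X [Y [mX mY h]]]]].
exists (a * p)%N, (b * p)%N, (X *t C), (Y *t C).
split; try exact: metabolic_tens.
apply: isom_trans (isom_sym (isom_tensDl _ _ _)) _.
apply: isom_trans (isom_tensDl _ _ _).
exact: isom_tens h (isom_refl _).
Qed.

Lemma witt_metabolic n (A : 'M[k]_n) (Z : 'M[k]_0) : metabolic A -> witt_rel A Z.
Proof.
move=> mA; exists 0, n, 0, A; split=> //; first exact: metabolic0.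
apply: isom_trans (isom_osumC _ _) _.
exact: isom_trans (isom_osum0 _ _) (isom_sym (isom_osum0 _ _)).
Qed.

Lemma metabolic_odd n (X : 'M[k]_n) : metabolic X -> odd n = false.
Proof. by case=> m [D [_ /isom_dim->]]; rewrite addnn odd_double. Qed.

Lemma witt_odd n m (A : 'M[k]_n) (B : 'M[k]_m) : witt_rel A B -> odd n = odd m.
Proof.
case=> p [q [X [Y [/metabolic_odd oX /metabolic_odd oY /isom_dim]]]].
by move/(congr1 odd); rewrite !oddD oX oY !addbF.
Qed.

End Isometry.

Section WittRing.
Variable k : fieldType.

Definition nondeg n (A : 'M[k]_n) : bool := (A^T == A) && (A \in unitmx).

Definition ndmx n := {A : 'M[k]_n | nondeg A}.
HB.instance Definition _ n := Choice.on (ndmx n).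

Definition ndform := {n : nat & ndmx n}.
HB.instance Definition _ := Choice.on ndform.

Definition fdim (q : ndform) : nat := tag q.
Definition fmx (q : ndform) : 'M[k]_(fdim q) := val (tagged q).
Definition NdForm n (A : 'M[k]_n) (ndA : nondeg A) : ndform :=
  Tagged ndmx (exist _ A ndA).

Lemma fmx_sym q : (fmx q)^T = fmx q.
Proof. by case: q => n [A h]; case/andP: (h) => /eqP. Qed.

Lemma fmx_unit q : fmx q \in unitmx.
Proof. by case: q => n [A h]; case/andP: (h). Qed.

Definition weq (q q' : ndform) : bool := `[< witt_rel (fmx q) (fmx q') >].

Lemma weq_equiv : equiv_class_of weq.
Proof.
split=> [q|q q'|q' q q''].
- by apply/asboolP; apply: isom_witt; apply: isom_refl.
- by apply: asbool_equiv_eq; split; apply: witt_sym.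
- move=> /asboolP h /asboolP h'; apply/asboolP; exact: witt_trans h h'.
Qed.

Canonical weq_equivrel := EquivRelPack weq_equiv.

Definition Witt := {eq_quot weq}.
HB.instance Definition _ : EqQuotient ndform weq Witt := EqQuotient.on Witt.
HB.instance Definition _ := Choice.on Witt.

Lemma nondeg_osum n m (A : 'M[k]_n) (B : 'M[k]_m) :
  nondeg A -> nondeg B -> nondeg (osum A B).
Proof.
move=> /andP[/eqP sA uA] /andP[/eqP sB uB]; rewrite /nondeg /osum.
rewrite tr_block_mx sA sB !trmx0 eqxx unitmxE det_ublock unitrM -!unitmxE.
by rewrite uA.
Qed.

Lemma nondeg_opp n (A : 'M[k]_n) : nondeg A -> nondeg (- A).
Proof.
move=> /andP[/eqP sA uA]; rewrite /nondeg linearN /= sA eqxx.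
by rewrite -scaleN1r unitmxZ // unitrN1.
Qed.

Lemma nondeg_tens n m (A : 'M[k]_n) (B : 'M[k]_m) :
  nondeg A -> nondeg B -> nondeg (A *t B).
Proof.
move=> /andP[/eqP sA uA] /andP[/eqP sB uB]; rewrite /nondeg trmx_tens sA sB eqxx.
suff /mulmx1_unit[] : (A *t B) *m (invmx A *t invmx B) = 1%:M by [].
by rewrite tensmx_mul !mulmxV // tens11.
Qed.

Lemma nondeg1 : nondeg (1%:M : 'M[k]_1).
Proof. by rewrite /nondeg trmx1 eqxx unitmx1. Qed.

Lemma nondeg0 : nondeg (0 : 'M[k]_0).
Proof. by rewrite /nondeg trmx0 eqxx unitmxE det_mx00 unitr1. Qed.

Definition nd (q : ndform) : nondeg (fmx q) := valP (tagged q).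

Definition form0 : ndform := NdForm nondeg0.
Definition form1 : ndform := NdForm nondeg1.
Definition formD q q' : ndform := NdForm (nondeg_osum (nd q) (nd q')).
Definition formN q : ndform := NdForm (nondeg_opp (nd q)).
Definition formM q q' : ndform := NdForm (nondeg_tens (nd q) (nd q')).

Lemma pi_witt q q' : witt_rel (fmx q) (fmx q') -> \pi_Witt q = \pi_Witt q'.
Proof. by move=> h; apply/eqmodP/asboolP. Qed.

Lemma pi_isom q q' : isometric (fmx q) (fmx q') -> \pi_Witt q = \pi_Witt q'.
Proof. by move=> /isom_witt/pi_witt. Qed.

Lemma witt_pi q q' : \pi_Witt q = \pi_Witt q' -> witt_rel (fmx q) (fmx q').
Proof. by move=> /eqmodP/asboolP. Qed.

Definition witt0 : Witt := lift_cst Witt form0.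
Definition witt1 : Witt := lift_cst Witt form1.
Definition wittD := lift_op2 Witt formD.
Definition wittN := lift_op1 Witt formN.
Definition wittM := lift_op2 Witt formM.

Canonical pi_witt0_morph := PiConst witt0.
Canonical pi_witt1_morph := PiConst witt1.

Lemma pi_wittD : {morph \pi : x y / formD x y >-> wittD x y}.
Proof.
move=> x y; unlock wittD; apply: pi_witt.
by apply: witt_osum; apply: witt_pi; rewrite reprK.
Qed.
Canonical pi_wittD_morph := PiMorph2 pi_wittD.

Lemma pi_wittM : {morph \pi : x y / formM x y >-> wittM x y}.
Proof.
move=> x y; unlock wittM; apply: pi_witt => /=.
apply: (@witt_trans _ _ _ _ _ (fmx (repr (\pi_Witt x)) *t fmx y)).
  apply: witt_tensl; rewrite ?fmx_sym ?fmx_unit //.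
  by apply: witt_pi; rewrite reprK.
apply: (witt_trans (isom_witt (isom_tensC _ _))).
apply: (fun h => witt_trans h (isom_witt (isom_tensC _ _))).
apply: witt_tensl; rewrite ?fmx_sym ?fmx_unit //.
by apply: witt_pi; rewrite reprK.
Qed.
Canonical pi_wittM_morph := PiMorph2 pi_wittM.

Lemma pi_wittDN x : \pi_Witt (formD (formN x) x) = \pi_Witt form0.
Proof.
apply: pi_witt; apply: witt_metabolic; apply: (metabolic_isom (isom_osumC _ _)).
by apply: metabolicN; rewrite ?fmx_sym ?fmx_unit.
Qed.

Lemma wittDA : associative wittD.
Proof.
move=> x y z; rewrite -[x]reprK -[y]reprK -[z]reprK !piE.
apply: pi_isom; exact: isom_osumA.
Qed.

Lemma wittDC : commutative wittD.
Proof.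
move=> x y; rewrite -[x]reprK -[y]reprK !piE; apply: pi_isom; exact: isom_osumC.
Qed.

Lemma wittD0 : left_id witt0 wittD.
Proof. move=> x; rewrite -[x]reprK !piE; apply: pi_isom; exact: isom_osum0. Qed.

Lemma pi_wittN : {morph \pi : x / formN x >-> wittN x}.
Proof.
move=> x; unlock wittN.
have addI y z t : wittD y t = witt0 -> wittD z t = witt0 -> y = z.
  move=> yt zt; rewrite -[y]wittD0 -zt -wittDA [wittD t y]wittDC yt.
  by rewrite wittDC wittD0.
apply: (addI _ _ (\pi_Witt x)).
  by rewrite -pi_wittD pi_wittDN piE.
by rewrite -[X in wittD _ X]reprK -pi_wittD pi_wittDN piE.
Qed.
Canonical pi_wittN_morph := PiMorph1 pi_wittN.

Lemma wittDN : left_inverse witt0 wittN wittD.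
Proof. by move=> x; rewrite -[x]reprK -pi_wittN -pi_wittD pi_wittDN piE. Qed.

Lemma wittMA : associative wittM.
Proof.
move=> x y z; rewrite -[x]reprK -[y]reprK -[z]reprK !piE.
apply: pi_isom; exact: isom_tensA.
Qed.

Lemma wittMC : commutative wittM.
Proof.
move=> x y; rewrite -[x]reprK -[y]reprK !piE; apply: pi_isom; exact: isom_tensC.
Qed.

Lemma wittM1 : left_id witt1 wittM.
Proof. move=> x; rewrite -[x]reprK !piE; apply: pi_isom; exact: isom_tens1. Qed.

Lemma wittMDl : left_distributive wittM wittD.
Proof.
move=> x y z; rewrite -[x]reprK -[y]reprK -[z]reprK !piE.
apply: pi_isom; exact: isom_tensDl.
Qed.

Lemma witt1_neq0 : witt1 != witt0.
Proof.
by apply/eqP; rewrite !piE => /witt_pi/witt_odd.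
Qed.

HB.instance Definition _ :=
  GRing.isZmodule.Build Witt wittDA wittDC wittD0 wittDN.
HB.instance Definition _ :=
  GRing.Zmodule_isComNzRing.Build Witt wittMA wittMC wittM1 wittMDl witt1_neq0.

Definition wrank (x : Witt) : 'F_2 := (fdim (repr x))%:R.

Lemma wrank_pi q : wrank (\pi_Witt q) = (fdim q)%:R.
Proof.
have nat2 n : n%:R = (odd n)%:R :> 'F_2.
  by rewrite -[LHS]Zp_nat_mod // modn2.
rewrite /wrank [LHS]nat2 [RHS]nat2; congr (_%:R); congr nat_of_bool.
by apply: witt_odd; apply: witt_pi; rewrite reprK.
Qed.

Lemma wrank_is_zmod_morphism : zmod_morphism wrank.
Proof.
move=> x y; rewrite -[x]reprK -[y]reprK.
have -> : \pi_Witt (repr x) - \pi_Witt (repr y)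
   = \pi_Witt (formD (repr x) (formN (repr y))) by rewrite pi_wittD pi_wittN.
by rewrite !wrank_pi /= natrD oppr_pchar2 // pchar_Fp.
Qed.

Lemma wrank_is_monoid_morphism : monoid_morphism wrank.
Proof.
split=> [|x y].
  have -> : 1 = \pi_Witt form1 by rewrite piE.
  by rewrite wrank_pi.
rewrite -[x]reprK -[y]reprK.
have -> : \pi_Witt (repr x) * \pi_Witt (repr y)
   = \pi_Witt (formM (repr x) (repr y)) by rewrite pi_wittM.
by rewrite !wrank_pi /= natrM.
Qed.

HB.instance Definition _ :=
  GRing.isZmodMorphism.Build Witt 'F_2 wrank wrank_is_zmod_morphism.
HB.instance Definition _ :=
  GRing.isMonoidMorphism.Build Witt 'F_2 wrank wrank_is_monoid_morphism.

Definition fundI : {pred Witt} := [pred x | wrank x == 0].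

Definition fundI2 : {pred Witt} :=
  [pred x | `[< exists s : seq (Witt * Witt),
     all (fun p => (p.1 \in fundI) && (p.2 \in fundI)) s /\
     x = \sum_(p <- s) p.1 * p.2 >] ].

Lemma fundI2_idealr : idealr_closed fundI2.
Proof.
split.
- by apply/asboolP; exists [::]; rewrite big_nil.
- apply/negP => /asboolP[s [/allP sI s1]].
  have: wrank 1 = 0.
    rewrite s1 rmorph_sum big_seq big1 // => p /sI /andP[/eqP p0 _].
    by rewrite rmorphM /= p0 mul0r.
  by rewrite rmorph1 => /eqP; rewrite oner_eq0.
- move=> a u v /asboolP[s [sI ->]] /asboolP[t [tI ->]]; apply/asboolP.
  exists ([seq (a * p.1, p.2) | p <- s] ++ t); split.
    rewrite all_cat tI andbT all_map; apply: sub_all sI => p /= /andP[p1 ->].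
    by rewrite inE rmorphM /= (eqP p1) mulr0 eqxx.
  rewrite big_cat big_map mulr_sumr; congr (_ + _).
  by apply: eq_bigr => p _; rewrite mulrA.
Qed.

HB.instance Definition _ := isIdealr.Build Witt fundI2 fundI2_idealr.

Definition WittModI2 := {ideal_quot fundI2}.
HB.instance Definition _ := GRing.ComNzRing.on WittModI2.

Definition modI2 (x : Witt) : WittModI2 := \pi_WittModI2 x.

Definition IModI2 (y : WittModI2) : Prop := exists2 x, x \in fundI & y = modI2 x.

End WittRing.

Section SymmetricForms.
Variable k : fieldType.

Definition symform n : {pred 'M[k]_n} := [pred A | A^T == A].

Lemma symformP n (A : 'M[k]_n) : reflect (A^T = A) (A \in @symform n).
Proof. exact: eqP. Qed.

Fact symform_zmod_closed n : zmod_closed (@symform n).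
Proof.
split=> [|A B /symformP sA /symformP sB]; apply/symformP.
  by rewrite trmx0.
by rewrite linearB /= sA sB.
Qed.
HB.instance Definition _ n :=
  GRing.isZmodClosed.Build 'M[k]_n (@symform n) (@symform_zmod_closed n).

Record symmx n := SymMx { symmx_val :> 'M[k]_n; _ : symmx_val \in @symform n }.
HB.instance Definition _ n := [isSub for @symmx_val n].
HB.instance Definition _ n := [Choice of symmx n by <:].
HB.instance Definition _ n := [SubChoice_isSubZmodule of symmx n by <:].

Lemma tr_symmx n (A : symmx n) : A^T = A.
Proof. exact/symformP/(valP A). Qed.

(* The rows of coimage_base A are a basis of a complement of the radical of
   A, hence represent a basis of the quotient by the radical. *)
Definition coimage_base n (A : 'M[k]_n) := row_base (kermx A)^C%MS.

Definition nondeg_part n (A : 'M[k]_n) :=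
  coimage_base A *m A *m (coimage_base A)^T.

Lemma nondeg_partP n (A : symmx n) : nondeg (nondeg_part A).
Proof.
rewrite /nondeg /nondeg_part; set B := coimage_base A.
have sB : (B *m A *m B^T)^T = B *m A *m B^T.
  by rewrite trmx_mul (trmx_mul B) trmxK tr_symmx mulmxA.
rewrite sB eqxx /=.
rewrite -row_free_unit -kermx_eq0 -submx0; apply/rV_subP => v.
rewrite sub_kermx => /eqP vBAB; rewrite submx0.
have vBC : (v *m B <= (kermx A)^C)%MS.
  by rewrite -(eq_row_base (kermx A)^C%MS) submxMl.
have vBA : v *m B *m A = 0.
  have vAC : v *m B *m A *m ((kermx A)^C%MS)^T = 0.
    have /submxP[D /(congr1 trmx) ->] : ((kermx A)^C <= B)%MS.
      by rewrite eq_row_base.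
    by rewrite (trmx_mul D) mulmxA -2!(mulmxA v) vBAB mul0mx.
  have vAK : v *m B *m A *m (kermx A)^T = 0.
    by rewrite -mulmxA -[X in _ *m (X *m _)]tr_symmx -trmx_mul mulmx_ker trmx0 mulmx0.
  have /sub_addsmxP[[D1 D2] /= E] : (1%:M <= kermx A + (kermx A)^C)%MS.
    by rewrite sub1mx addsmx_compl_full.
  rewrite -[LHS]mulmx1 -trmx1 E linearD /= mulmxDr (trmx_mul D1) (trmx_mul D2).
  by rewrite 2!(mulmxA _ _ _^T) vAC vAK !mul0mx addr0.
have vB0 : v *m B = 0.
  apply/eqP; rewrite -submx0 -(capmx_compl (kermx A)) sub_capmx vBC andbT.
  by rewrite sub_kermx vBA.
have: row_free B by rewrite /B /coimage_base row_base_free.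
by rewrite -kermx_eq0 => /eqP kB; rewrite -submx0 -kB sub_kermx vB0.
Qed.

Definition witt_class n (A : symmx n) : Witt k :=
  \pi_(Witt k) (NdForm (nondeg_partP A)).

Lemma dform_sym (s : seq k) : diag_mx (\row_(i < size s) s`_i) \in @symform (size s).
Proof. by apply/symformP; rewrite tr_diag_mx. Qed.

Definition dform (s : seq k) : symmx (size s) := SymMx (dform_sym s).

Definition sdisc (q : ndform k) : k :=
  (-1) ^+ (fdim q * (fdim q).-1)./2 * \det (fmx q).

Definition same_sqclass (a b : k) : Prop := exists2 c, c != 0 & a = b * c ^+ 2.

(* d represents the square class of y under the discriminant identification
   of I / I^2 with the group of square classes of k *)
Definition has_disc (y : WittModI2 k) (d : k) : Prop :=
  forall q : ndform k, modI2 (\pi_(Witt k) q) = y -> same_sqclass (sdisc q) d.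

End SymmetricForms.

(* The free product of two copies of the additive group V, as reduced words.
   The letter (b, a) is the element a of the copy labelled b. *)
Section FreeProduct.
Variable V : zmodType.
Implicit Types (l : bool * V) (w : seq (bool * V)).

Definition fp_reduced w : bool :=
  sorted (fun l l' => l.1 != l'.1) w && all (fun l => l.2 != 0) w.

Record freeprod := FreeProd { fp_word :> seq (bool * V); _ : fp_reduced fp_word }.
HB.instance Definition _ := [isSub for fp_word].
HB.instance Definition _ := [Choice of freeprod by <:].

Definition fp_push l w : seq (bool * V) :=
  if l.2 == 0 then w else
  if w is l' :: w' then
    if l.1 == l'.1 then
      if l.2 + l'.2 == 0 then w' else (l.1, l.2 + l'.2) :: w'
    else l :: w
  else [:: l].

Lemma fp_reduced_cons l w : fp_reduced (l :: w) ->
  [/\ l.2 != 0, fp_reduced w & fp_push l w = l :: w].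
Proof.
case: w => [|l' w] /andP[/= pw /andP[l0 aw]].
  by rewrite /fp_push (negPf l0).
case/andP: pw aw => ll' pw /andP[l'0 aw]; split=> //.
  by rewrite /fp_reduced /= pw l'0.
by rewrite /fp_push (negPf l0) (negPf ll').
Qed.

Lemma fp_reduced_push l w : fp_reduced w -> fp_reduced (fp_push l w).
Proof.
rewrite /fp_push; case: eqP => // /eqP l0.
case: w => [|[b' a'] w] rw; first by rewrite /fp_reduced /= l0.
case: eqP => [bb|/eqP bb] /=; last first.
  by move: rw; rewrite /fp_reduced /= bb l0.
have [_ rw' _] := fp_reduced_cons rw.
case: eqP => // /eqP n0; move: rw; rewrite /fp_reduced /= n0 bb /=.
by case: w {rw'} => [|m w] //= /andP[-> /andP[_ ->]].
Qed.

Lemma fp_push_push b a a' w : fp_reduced w ->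
  fp_push (b, a) (fp_push (b, a') w) = fp_push (b, a + a') w.
Proof.
move=> rw; rewrite {2}/fp_push /=; case: (a' =P 0) => [->|/eqP a'0].
  by rewrite addr0.
have push0 : a + a' == 0 -> fp_push (b, a + a') w = w.
  by rewrite /fp_push /= => ->.
case: w rw push0 => [|[c d] w] rw push0.
  rewrite /fp_push /= eqxx; case: (a =P 0) => [->|/eqP a0].
    by rewrite add0r (negPf a'0).
  by [].
rewrite /=; case: eqP => [bc|/eqP bc]; last first.
  rewrite /fp_push /= eqxx (negPf bc); case: (a =P 0) => [->|/eqP a0].
    by rewrite add0r (negPf a'0).
  by [].
subst c; have [/= d0 rw' pw] := fp_reduced_cons rw.
case: eqP => [a'd|/eqP a'd].
  have -> : d = - a' by apply/eqP; rewrite -addr_eq0 addrC a'd.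
  have pw' : fp_push (b, a) w = if a == 0 then w else (b, a) :: w.
    rewrite /fp_push /=; case: (a == 0) => //.
    by case: w rw {pw push0 rw'} => // l w /andP[/= /andP[/negPf-> _]].
  rewrite pw' /fp_push /= eqxx addrK.
  case: (a =P 0) => [->|/eqP a0]; first by rewrite add0r (negPf a'0).
  case: (a + a' =P 0) => // aa'; congr ((_, _) :: _).
  by apply/eqP; rewrite -addr_eq0 aa'.
rewrite /fp_push /= eqxx addrA.
case: (a =P 0) => [->|/eqP a0]; first by rewrite !add0r (negPf a'0) (negPf a'd).
case: (a + a' =P 0) => [aa'|//].
by rewrite aa' add0r (negPf d0).
Qed.

Definition fp_cat u w := foldr fp_push w u.

Lemma fp_reduced_cat u w : fp_reduced w -> fp_reduced (fp_cat u w).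
Proof. by move=> rw; elim: u => //= l u; apply: fp_reduced_push. Qed.

Lemma fp_cat_push l u w : fp_reduced w ->
  fp_cat (fp_push l u) w = fp_push l (fp_cat u w).
Proof.
move=> rw; case: l => b a; rewrite {1}/fp_push /=.
case: (a =P 0) => [->|/eqP a0]; first by rewrite /fp_push eqxx.
case: u => // [[c d] u]; rewrite /=; case: eqP => [<-|//].
rewrite fp_push_push ?fp_reduced_cat //.
by case: eqP => // ->; rewrite /fp_push eqxx.
Qed.

Lemma fp_catA u v w : fp_reduced w ->
  fp_cat u (fp_cat v w) = fp_cat (fp_cat u v) w.
Proof. by move=> rw; elim: u => //= l u ->; rewrite fp_cat_push. Qed.

Lemma fp_cat0 w : fp_reduced w -> fp_cat w [::] = w.
Proof. by elim: w => //= l w IH /fp_reduced_cons[_ /IH-> ->]. Qed.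

Definition fp_opp w := rev [seq (l.1, - l.2) | l <- w].

Lemma fp_oppK : involutive fp_opp.
Proof.
move=> w; rewrite /fp_opp map_rev revK -map_comp -[RHS]map_id.
by apply: eq_map => -[b a] /=; rewrite opprK.
Qed.

Lemma fp_reduced_opp w : fp_reduced w -> fp_reduced (fp_opp w).
Proof.
case/andP=> pw aw; rewrite /fp_reduced /fp_opp rev_sorted all_rev all_map.
apply/andP; split; last by apply: sub_all aw => l /=; rewrite oppr_eq0.
rewrite sorted_map; apply: sub_sorted pw => l l' /=; by rewrite eq_sym.
Qed.

Lemma fp_catN w : fp_reduced w -> fp_cat (fp_opp w) w = [::].
Proof.
elim: w => // -[b a] w IH rw; have [a0 rw' _] := fp_reduced_cons rw.
rewrite /fp_cat /fp_opp map_cons rev_cons -cats1 foldr_cat /=.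
by rewrite {2}/fp_push /= oppr_eq0 (negPf a0) eqxx addNr eqxx; apply: IH.
Qed.

Definition fp_mul (x y : freeprod) : freeprod :=
  FreeProd (fp_reduced_cat x (valP y)).
Definition fp_one : freeprod := @FreeProd [::] isT.
Definition fp_inv (x : freeprod) : freeprod := FreeProd (fp_reduced_opp (valP x)).

Lemma fp_mulA : associative fp_mul.
Proof. by move=> x y z; apply: val_inj; rewrite /= fp_catA //; apply: valP. Qed.
Lemma fp_mul1 : left_id fp_one fp_mul.
Proof. by move=> x; apply: val_inj. Qed.
Lemma fp_mulr1 : right_id fp_one fp_mul.
Proof. by move=> x; apply: val_inj; rewrite /= fp_cat0 //; apply: valP. Qed.
Lemma fp_mulV : left_inverse fp_one fp_inv fp_mul.
Proof. by move=> x; apply: val_inj; rewrite /= fp_catN //; apply: valP. Qed.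
Lemma fp_mulrV : right_inverse fp_one fp_inv fp_mul.
Proof.
move=> x; rewrite -[X in fp_mul X _](_ : fp_inv (fp_inv x) = x) ?fp_mulV //.
by apply: val_inj; rewrite /= fp_oppK.
Qed.

HB.instance Definition _ :=
  isGroup.Build freeprod fp_mulA fp_mul1 fp_mulr1 fp_mulV fp_mulrV.

Definition fp_in (b : bool) (a : V) : freeprod :=
  FreeProd (@fp_reduced_push (b, a) [::] isT).

End FreeProduct.

Section SymplecticGroup.
Variables (k : fieldType) (g : nat).

(* Matrix, on column vectors, of omega((x, xi), (y, eta)) = xi(y) - eta(x);
   L^* = k^g carries the basis dual to that of L = k^g. *)
Definition omega : 'M[k]_(g + g) := block_mx 0 (- 1%:M) 1%:M 0.

Definition symplectic : {pred 'M[k]_(g + g)} :=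
  [pred M | M^T *m omega *m M == omega].

Record Sp := SpElt { Sp_mx :> 'M[k]_(g + g); _ : Sp_mx \in symplectic }.
HB.instance Definition _ := [isSub for Sp_mx].
HB.instance Definition _ := [Choice of Sp by <:].

Lemma symplecticP (M : 'M[k]_(g + g)) :
  reflect (M^T *m omega *m M = omega) (M \in symplectic).
Proof. exact: eqP. Qed.

Lemma omegaVl : omega^T *m omega = 1%:M.
Proof.
rewrite /omega tr_block_mx linearN /= !trmx0 !trmx1 mulmx_block.
rewrite !(mulmx0, mul0mx, addr0, add0r, mulmx1, mul1mx) mulmxN mulNmx mulmx1.
by rewrite opprK -scalar_mx_block.
Qed.

Lemma omegaVr : omega *m omega^T = 1%:M.
Proof. exact: mulmx1C omegaVl. Qed.

Lemma tr_omega : omega^T = - omega.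
Proof.
by rewrite /omega tr_block_mx linearN /= !trmx0 !trmx1 opp_block_mx !oppr0 opprK.
Qed.

Definition sp_inv (M : 'M[k]_(g + g)) := omega^T *m M^T *m omega.

Lemma sp_invVl M : M \in symplectic -> sp_inv M *m M = 1%:M.
Proof.
by move/symplecticP=> h; rewrite /sp_inv -!mulmxA (mulmxA M^T) h omegaVl.
Qed.

Lemma sp_invVr M : M \in symplectic -> M *m sp_inv M = 1%:M.
Proof. by move/sp_invVl/mulmx1C. Qed.

Lemma sp1_subproof : 1%:M \in symplectic.
Proof. by apply/symplecticP; rewrite trmx1 mul1mx mulmx1. Qed.

Lemma sp_mul_subproof (M N : Sp) : val M *m val N \in symplectic.
Proof.
apply/symplecticP; rewrite trmx_mul -!mulmxA (mulmxA (val M)^T).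
rewrite (mulmxA _ (val M)) (symplecticP _ (valP M)) mulmxA.
exact/symplecticP/(valP N).
Qed.

Lemma sp_inv_subproof (M : Sp) : sp_inv (val M) \in symplectic.
Proof.
have h := sp_invVr (valP M); apply/symplecticP.
rewrite -{1}(symplecticP _ (valP M)) -!mulmxA h mulmx1 mulmxA -trmx_mul h.
by rewrite trmx1 mul1mx.
Qed.

Definition sp_one : Sp := SpElt sp1_subproof.
Definition sp_mul (M N : Sp) : Sp := SpElt (sp_mul_subproof M N).
Definition sp_invg (M : Sp) : Sp := SpElt (sp_inv_subproof M).

Lemma sp_mulA : associative sp_mul.
Proof. by move=> x y z; apply: val_inj; rewrite /= mulmxA. Qed.
Lemma sp_mul1 : left_id sp_one sp_mul.
Proof. by move=> x; apply: val_inj; rewrite /= mul1mx. Qed.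
Lemma sp_mulr1 : right_id sp_one sp_mul.
Proof. by move=> x; apply: val_inj; rewrite /= mulmx1. Qed.
Lemma sp_mulV : left_inverse sp_one sp_invg sp_mul.
Proof. by move=> x; apply: val_inj; apply: sp_invVl (valP x). Qed.
Lemma sp_mulrV : right_inverse sp_one sp_invg sp_mul.
Proof. by move=> x; apply: val_inj; apply: sp_invVr (valP x). Qed.

HB.instance Definition _ :=
  isGroup.Build Sp sp_mulA sp_mul1 sp_mulr1 sp_mulV sp_mulrV.

Definition StabL : {pred Sp} :=
  [pred M : Sp | `[< forall v : 'cV[k]_g,
     exists w : 'cV[k]_g, val M *m col_mx v 0 = col_mx w 0 >] ].

Lemma StabLP (M : Sp) : reflect (dlsubmx (val M) = 0) (M \in StabL).
Proof.
apply: (iffP (asboolP _)) => [h|h v].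
  apply/matrixP=> i j; have [w] := h (delta_mx j 0).
  rewrite -{1}(submxK (val M)) mul_block_col !mulmx0 !addr0 => /eq_col_mx[_].
  by rewrite -colE => /(congr1 (fun A : 'cV[k]_g => A i 0)); rewrite !mxE.
exists (ulsubmx (val M) *m v).
by rewrite -{1}(submxK (val M)) mul_block_col !mulmx0 !addr0 h mul0mx.
Qed.

Lemma StabL1 : 1%g \in StabL.
Proof. by apply/asboolP => v; exists v; rewrite mul1mx. Qed.

Lemma StabLM : mulg_closed StabL.
Proof.
move=> M N /asboolP hM /asboolP hN; apply/asboolP => v.
have [w Nv] := hN v; have [w' Mw] := hM w; exists w'.
by rewrite -Mw -Nv mulmxA.
Qed.

Lemma StabLV : invg_closed StabL.
Proof.
move=> M /StabLP hM; apply/StabLP.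
rewrite /= /sp_inv -(submxK (val M)) hM tr_block_mx /omega tr_block_mx.
rewrite !mulmx_block block_mxKdl linearN /= !trmx0 !trmx1.
by rewrite !(mulmx0, mul0mx, addr0, add0r, mulmx1, mul1mx) ?oppr0.
Qed.

HB.instance Definition _ := isMul1Closed.Build Sp StabL StabL1.
HB.instance Definition _ := isMulClosed.Build Sp StabL StabLM.
HB.instance Definition _ := isInvClosed.Build Sp StabL StabLV.

Definition StabL_proj (M : Sp) : 'M[k]_g := ulsubmx (val M).

(* For the parity b of an index j and q : L_j -> L_(j+1), the matrix E(q). *)
Definition elem_mx (b : bool) (q : 'M[k]_g) : 'M[k]_(g + g) :=
  if b then block_mx 1%:M q 0 1%:M else block_mx 1%:M 0 q 1%:M.

Lemma elem_subproof b (q : symmx k g) : elem_mx b q \in symplectic.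
Proof.
apply/symplecticP; rewrite /elem_mx /omega.
case: b; rewrite tr_block_mx !trmx0 !trmx1 tr_symmx !mulmx_block;
by rewrite !(mulmx0, mul0mx, addr0, add0r, mulmx1, mul1mx) ?mulmxN ?mulNmx
  ?mulmx1 ?mul1mx ?(mulmxN, mulNmx, mulmx1, mul1mx) ?oppr0 ?addr0 ?subrr ?addNr.
Qed.

Definition elem (b : bool) (q : symmx k g) : Sp := SpElt (elem_subproof b q).

(* Copy false of the free product is S_(L^* ), copy true is S_L. *)
Definition freeS := freeprod (symmx k g).
HB.instance Definition _ := Group.on freeS.

Definition evalE (w : freeS) : Sp :=
  (\prod_(l <- fp_word w) elem l.1 l.2)%g.

Lemma elemD b (q q' : symmx k g) : elem b (q + q') = (elem b q * elem b q')%g.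
Proof.
apply: val_inj; rewrite /= /elem_mx; case: b; rewrite mulmx_block;
by rewrite !(mulmx0, mul0mx, addr0, add0r, mulmx1, mul1mx) // addrC.
Qed.

Lemma elem0 b : elem b 0 = 1%g.
Proof.
by apply: val_inj; rewrite /= /elem_mx; case: b; rewrite -scalar_mx_block.
Qed.

Lemma evalE_push l (w : seq (bool * symmx k g)) :
  (\prod_(m <- fp_push l w) elem m.1 m.2)%g
  = (elem l.1 l.2 * \prod_(m <- w) elem m.1 m.2)%g.
Proof.
case: l => b a; rewrite /fp_push /=; case: eqP => [->|_].
  by rewrite elem0 mul1g.
case: w => [|[c d] w]; first by rewrite big_seq1 big_nil mulg1.
rewrite /=; case: eqP => [<-|_]; last by rewrite !big_cons.
case: eqP => [ad|_]; last by rewrite !big_cons elemD mulgA.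
by rewrite big_cons mulgA -elemD ad elem0 mul1g.
Qed.

Lemma evalE_is_monoid_morphism : (evalE 1%g = 1%g) * {morph evalE : x y / (x * y)%g}.
Proof.
split; first by rewrite /evalE big_nil.
move=> x y; rewrite /evalE /= /fp_cat.
elim: (fp_word x) => [|l u IH] /=; first by rewrite big_nil mul1g.
by rewrite evalE_push IH big_cons mulgA.
Qed.
HB.instance Definition _ := isUMagmaMorphism.Build freeS Sp evalE
  evalE_is_monoid_morphism.

Lemma evalE_in b q : evalE (fp_in b q) = elem b q.
Proof. by rewrite /evalE evalE_push big_nil mulg1. Qed.

(* The pair (m, [:: q_m; ...; q_n]) is the sequence (q_m, ..., q_n); the last
   index n is m + size - 1. *)
Definition sturm := (int * seq (symmx k g))%type.

Definition oddz (j : int) : bool := odd `|j|%N.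

Definition sturm_first (s : sturm) : int := s.1.
Definition sturm_len (s : sturm) : nat := size s.2.
Definition sturm_last (s : sturm) : int := sturm_first s + (sturm_len s)%:Z - 1.
Definition sturm_map (s : sturm) (i : nat) : symmx k g := s.2`_i.
Definition sturm_odd (s : sturm) (i : nat) : bool := oddz (sturm_first s + i%:Z).

Definition sturm_prod (s : sturm) : freeS :=
  (\prod_(i < sturm_len s) (fp_in (sturm_odd s i) (sturm_map s i) : freeS))%g.

Definition type00 (s : sturm) : bool :=
  ~~ oddz (sturm_first s) && ~~ oddz (sturm_last s).

Definition sylvester_mx (s : sturm) : 'M[k]_(\sum_(i < sturm_len s) g) :=
  \mxblock_(i < sturm_len s, j < sturm_len s)
    (if i == j then (-1) ^+ sturm_odd s i *: (sturm_map s i : 'M[k]_g)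
     else if (j == i.+1 :> nat) || (i == j.+1 :> nat) then 1%:M
     else 0).

Lemma sylvester_sym s : sylvester_mx s \in @symform k _.
Proof.
apply/symformP; rewrite /sylvester_mx tr_mxblock.
apply: eq_mxblock => i j; rewrite eq_sym; case: eqP => [->|_].
  by rewrite linearZ /= tr_symmx.
by rewrite orbC; case: ifP => _; rewrite ?trmx1 ?trmx0.
Qed.

Definition sylvester (s : sturm) : symmx k _ := SymMx (sylvester_sym s).

(* f_00(w) does not depend on the representing sequence of type 00, nor
   Phi(M) on the lift of M; xget picks one, the first argument being a default
   value that is irrelevant since such elements always exist. *)
Definition f00 (w : freeS) : Witt k :=
  witt_class (sylvester
    (xget (0, [:: 0]) [set s : sturm | type00 s /\ sturm_prod s = w]%classic)).

Definition Phi (M : Sp) : WittModI2 k :=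
  modI2 (f00 (xget 1%g [set w : freeS | evalE w = M]%classic)).

End SymplecticGroup.

(* Main.v *)
Require Import Defs.
From HB Require Import structures.
From mathcomp Require Import all_boot all_order all_algebra.
From mathcomp Require Import perm mxtens ring_quotient boolp classical_sets ring.

(** Both the lift of an element M of Stab_L to the free product and the Sturm
    sequence representing this lift are chosen arbitrarily in the definition
    of Phi.  The proof therefore computes, for an arbitrary type 00 sequence
    (q_0, ..., q_2n) whose product evaluates to M, the class modulo I^2 of its
    Sylvester matrix S.

    Let x and c be the upper left and lower left blocks of M, so that c = 0.
    Eliminating the variables of L_0, L_1, ... one after the other in S is the
    same recursion as multiplying the elementary matrices E(q_0), E(q_1), ...
    (continuant_alt_elem_mx), and it has two consequences.
    - The elimination ends with the block c up to sign.  Since c = 0, there is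
      a row combination of S that vanishes and whose first coefficient is
      invertible, hence S is isometric to 0 + T where T is S with its first
      block row and column deleted (tridiag_split_radical).
    - Applied to T, the elimination ends with x up to sign, which gives
      det T = (-1)^(n g) det x; as T has rank 2 n g, its signed discriminant
      is exactly det x (signed_disc_truncation).
    So the class of S is that of a nondegenerate form of even rank and signed
    discriminant det x, like <1, - det x>.

    Forms of even rank are classified modulo I^2 by their signed discriminant.
    One direction holds because <1, -a> <1, -b> lies in I^2, so that
    a |-> <a> - <1> is additive modulo I^2, and because forms are
    diagonalizable when 2 is invertible (modI2_signed_disc).  For the other
    direction, metabolic forms and tensor products of even-rank forms have
    square signed discriminant (signed_disc_modI2).

    All this requires that a lift exists, which is proved directly for
    Stab_L (liftable_stab).  An element of Stab_L is diag(x, x^-T) times an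
    elementary matrix; for symmetric x, diag(x, x^-1) is a product of two Weyl
    elements, and symmetric matrices generate GL_g in characteristic not 2
    (unitmx_sym_prod). *)

Set Implicit Arguments.
Unset Strict Implicit.
Unset Printing Implicit Defensive.

Import GRing.Theory.

Local Open Scope ring_scope.
Local Open Scope quotient_scope.

(** * Radicals and signed discriminants of symmetric forms *)
Section Forms.
Variable k : fieldType.

Lemma nondegP n (A : 'M[k]_n) : reflect (A^T = A /\ A \in unitmx) (nondeg A).
Proof. by apply: (iffP andP) => -[/eqP]. Qed.

Lemma isometric_nondeg n m (A : 'M[k]_n) (B : 'M[k]_m) :
  isometric A B -> nondeg B -> nondeg A.
Proof.
move=> AB; have e := isom_dim AB; subst m.
case: AB => P [Q [PQ QP <-]] /nondegP[sB uB]; apply/nondegP.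
have [uP _] := mulmx1_unit PQ.
by rewrite !trmx_mul trmxK sB mulmxA !unitmx_mul unitmx_tr uP uB.
Qed.

(** The sizes n and m are kept apart because below n is a rank, which is equal
    to m only propositionally. *)
Lemma mulmx1C_eqdim n m (C : 'M[k]_(n, m)) (X : 'M[k]_(m, n)) :
  n = m -> C *m X = 1%:M -> X *m C = 1%:M.
Proof. by move=> e; subst m; apply: mulmx1C. Qed.

Lemma rank_isometric n m (A : 'M[k]_n) (B : 'M[k]_m) :
  isometric A B -> \rank A = \rank B.
Proof.
move=> AB; have e := isom_dim AB; subst m.
case: AB => P [Q [/mulmx1_unit[uP _] _ <-]].
by rewrite mxrankMfree ?row_free_unit ?unitmx_tr // eqmxMfull ?row_full_unit.
Qed.

(** The form induced on the quotient by the radical can be computed on any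
    complement of the radical: if B spans the chosen complement and P gives
    the isometry, the last columns of B P identify it with the support of T. *)
Lemma witt_class_radical n p m (S : symmx k n) (T : 'M[k]_m) (ndT : nondeg T) :
  isometric (S : 'M[k]_n) (osum (0 : 'M[k]_p) T) ->
  witt_class S = \pi_(Witt k) (NdForm ndT).
Proof.
move=> iST; apply: pi_isom; rewrite /fmx /=.
have [_ uT] := nondegP _ ndT.
have rS : \rank (kermx S)^C = m.
  rewrite mxrank_compl mxrank_ker subKn ?rank_leq_row //.
  by rewrite (rank_isometric iST) rank_diag_block_mx mxrank0 mxrank_unit.
have /nondegP[_] := nondeg_partP S; rewrite /nondeg_part.
move: (coimage_base S) rS => /=; case: iST => P [Q [_ _ <-]].
move: (\rank _) => r B rm uN.
pose C := B *m rsubmx P.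
have CTC : B *m (P *m osum 0 T *m P^T) *m B^T = C *m T *m C^T.
  rewrite -[P in LHS]hsubmxK /osum tr_row_mx mul_row_block mul_row_col.
  by rewrite !(mulmx0, mul0mx, addr0, add0r) /C trmx_mul !mulmxA.
have CX : C *m (T *m C^T *m invmx (C *m T *m C^T)) = 1%:M.
  by rewrite !mulmxA mulmxV // -CTC.
exists C, (T *m C^T *m invmx (C *m T *m C^T)).
by split=> //; apply: mulmx1C_eqdim.
Qed.

Lemma witt_class_nondeg n (S : symmx k n) (ndS : nondeg (S : 'M[k]_n)) :
  witt_class S = \pi_(Witt k) (NdForm ndS).
Proof. exact: witt_class_radical (isom_sym (isom_osum0 0 _)). Qed.

(** On ndforms this is convertible to sdisc; it is stated for matrices so that
    it applies to blocks and tensor products. *)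
Definition signed_disc n (A : 'M[k]_n) : k := (-1) ^+ (n * n.-1)./2 * \det A.

Lemma same_sqclass_refl (a : k) : same_sqclass a a.
Proof. by exists 1; rewrite ?oner_eq0 // expr1n mulr1. Qed.

Lemma same_sqclass_sym (a b : k) : same_sqclass a b -> same_sqclass b a.
Proof.
case=> c c0 ->; exists c^-1; rewrite ?invr_eq0 //.
by rewrite -mulrA -exprMn divff // expr1n mulr1.
Qed.

Lemma same_sqclass_trans (a b c : k) :
  same_sqclass a b -> same_sqclass b c -> same_sqclass a c.
Proof.
case=> x x0 -> [y y0 ->]; exists (y * x); first by rewrite mulf_neq0.
by rewrite exprMn [RHS]mulrA.
Qed.

Lemma same_sqclassM (a b c d : k) :
  same_sqclass a b -> same_sqclass c d -> same_sqclass (a * c) (b * d).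
Proof.
case=> x x0 -> [y y0 ->]; exists (x * y); first by rewrite mulf_neq0.
by rewrite exprMn mulrACA.
Qed.

Lemma same_sqclass_sqr (c : k) : c != 0 -> same_sqclass (c ^+ 2) 1.
Proof. by exists c; rewrite ?mul1r. Qed.

Lemma det_isometric n m (A : 'M[k]_n) (B : 'M[k]_m) :
  isometric A B -> same_sqclass (\det A) (\det B).
Proof.
move=> AB; have e := isom_dim AB; subst m.
case: AB => P [Q [/mulmx1_unit[uP _] _ <-]].
exists (\det P); first by move: uP; rewrite unitmxE unitfE.
by rewrite !det_mulmx det_tr mulrAC mulrC.
Qed.

Lemma signed_disc_isometric n m (A : 'M[k]_n) (B : 'M[k]_m) :
  isometric A B -> same_sqclass (signed_disc A) (signed_disc B).
Proof.
move=> AB; have e := isom_dim AB; subst m.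
exact: same_sqclassM (same_sqclass_refl _) (det_isometric AB).
Qed.

Lemma signed_disc_double m n (A : 'M[k]_n) :
  n = m.*2 -> signed_disc A = (-1) ^+ m * \det A.
Proof.
move=> e; rewrite /signed_disc; congr (_ * _).
rewrite e -signr_odd -[RHS]signr_odd; congr (_ ^+ _).
rewrite -doubleMl doubleK oddM; case: m {e} => // m.
by rewrite doubleS /= odd_double andbT.
Qed.

(** The sign (-1)^(n(n-1)/2) is multiplicative only on even ranks, where it
    equals (-1)^(n/2). *)
Lemma signed_disc_osum n m (A : 'M[k]_n) (B : 'M[k]_m) : ~~ odd n -> ~~ odd m ->
  signed_disc (osum A B) = signed_disc A * signed_disc B.
Proof.
move=> /even_halfK en /even_halfK em.
rewrite (signed_disc_double _ (esym en)) (signed_disc_double _ (esym em)).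
rewrite (@signed_disc_double (n./2 + m./2)) ?doubleD ?en ?em // /osum det_ublock.
by rewrite exprD mulrACA.
Qed.

(** The matrix exchanges the m first coordinates with those selected by r and
    s; for r = s = 1 it is the usual hyperbolic Gram matrix. *)
Lemma det_swap_block m n (r : 'M[k]_(m, n)) (s : 'M[k]_(n, m)) :
  r *m s = 1%:M ->
  \det (block_mx 0 r s (1%:M - s *m r)) = (-1) ^+ m.
Proof.
move=> rs.
have -> : block_mx 0 r s (1%:M - s *m r) =
   block_mx 1%:M r 0 1%:M *m block_mx (- 1%:M) 0 s 1%:M
     *m block_mx 1%:M (- r) 0 1%:M.
  rewrite !mulmx_block !(mulmx0, mul0mx, addr0, add0r, mulmx1, mul1mx) rs addNr.
  by rewrite mul0mx add0r mulmxN addrC.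
rewrite !det_mulmx !det_ublock det_lblock !det1 !(mulr1, mul1r).
by rewrite -scaleN1r detZ det1 mulr1.
Qed.

Lemma signed_disc_metab m (D : 'M[k]_m) : signed_disc (metab D) = 1.
Proof.
rewrite (signed_disc_double (m := m)) ?addnn // /metab.
have -> : block_mx 0 1%:M 1%:M D =
  block_mx 0 1%:M 1%:M (1%:M - 1%:M *m 1%:M) *m block_mx 1%:M D 0 1%:M.
  rewrite !mulmx_block !(mulmx0, mul0mx, addr0, add0r, mulmx1, mul1mx).
  by rewrite subrr addr0.
rewrite det_mulmx det_swap_block ?mulmx1 // det_ublock !det1 !mulr1.
by rewrite -exprD addnn -signr_odd odd_double.
Qed.

Lemma signed_disc_witt n m (A : 'M[k]_n) (B : 'M[k]_m) :
  ~~ odd n -> witt_rel A B -> same_sqclass (signed_disc A) (signed_disc B).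
Proof.
move=> en AB; have em : ~~ odd m by rewrite -(witt_odd AB).
case: AB => p [q [X [Y [mX mY /signed_disc_isometric]]]].
rewrite !signed_disc_osum ?(metabolic_odd mX) ?(metabolic_odd mY) // => h.
have m1 l (Z : 'M[k]_l) : metabolic Z -> same_sqclass (signed_disc Z) 1.
  by case=> d [D [_ /signed_disc_isometric]]; rewrite signed_disc_metab.
have hA := same_sqclassM (same_sqclass_refl (signed_disc A)) (m1 _ _ mX).
have hB := same_sqclassM (same_sqclass_refl (signed_disc B)) (m1 _ _ mY).
rewrite !mulr1 in hA hB.
exact: same_sqclass_trans (same_sqclass_sym hA) (same_sqclass_trans h hB).
Qed.

(** Only the square class of a determinant of a tensor product matters, so
    that the block decomposition of 1 (x) C may be used up to isometry. *)
Lemma det_tens1 n p (C : 'M[k]_n) :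
  same_sqclass (\det ((1%:M : 'M[k]_p) *t C)) (\det C ^+ p).
Proof.
elim: p => [|p IH]; first by rewrite det_mx00 expr0; apply: same_sqclass_refl.
rewrite (@scalar_mx_block _ 1 p).
have /det_isometric := isom_tensDl (1%:M : 'M[k]_1) (1%:M : 'M[k]_p) C.
rewrite [\det (osum _ _)]det_ublock exprS => h; apply: same_sqclass_trans h _.
exact: same_sqclassM (det_isometric (isom_tens1 _)) IH.
Qed.

Lemma signed_disc_tens n m (A : 'M[k]_n) (B : 'M[k]_m) :
  ~~ odd n -> ~~ odd m -> nondeg A -> nondeg B ->
  same_sqclass (signed_disc (A *t B)) 1.
Proof.
move=> en em /nondegP[_ uA] /nondegP[_ uB].
rewrite (@signed_disc_double (n./2 * m)); last by rewrite doubleMl even_halfK.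
rewrite -signr_odd oddM (negPf em) andbF expr0 mul1r.
rewrite tensmx_decr det_mulmx.
have sqM (c : k) p : c \is a GRing.unit -> ~~ odd p -> same_sqclass (c ^+ p) 1.
  move=> uc /even_halfK <-; rewrite -muln2 exprM; apply: same_sqclass_sqr.
  by rewrite expf_neq0 // -unitfE.
have := same_sqclass_trans (det_isometric (isom_tensC A 1%:M)) (det_tens1 m A).
move=> /same_sqclassM/(_ (det_tens1 n B)) h.
apply: same_sqclass_trans h _; rewrite -(mulr1 1).
by apply: same_sqclassM; apply: sqM; rewrite -?unitmxE.
Qed.

(** A sum of products of even-rank classes is represented by the orthogonal
    sum of the tensor products of even-rank representatives. *)
Lemma fundI2_repr_signed_disc (x : Witt k) : x \in @fundI2 k ->
  exists2 r : ndform k, x = \pi_(Witt k) r &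
    ~~ odd (fdim r) /\ same_sqclass (signed_disc (fmx r)) 1.
Proof.
have even (y : Witt k) : y \in @fundI k -> ~~ odd (fdim (repr y)).
  rewrite inE /wrank; set n := fdim _ => /eqP/(congr1 val).
  by rewrite /= val_Fp_nat // modn2; case: odd.
case/asboolP => s [/allP sI ->]; elim: s sI => [|p s IH] sI.
  rewrite big_nil; exists (form0 k); first by rewrite piE.
  split=> //; rewrite /signed_disc /fmx /= det_mx00 mulr1.
  exact: same_sqclass_refl.
have [|r Er [er dr]] := IH; first by move=> q qs; apply: sI; rewrite inE qs orbT.
have /andP[/even e1 /even e2] := sI p (mem_head _ _).
exists (Defs.formD (Defs.formM (repr p.1) (repr p.2)) r).
  by rewrite big_cons Er -[p.1 in LHS]reprK -[p.2 in LHS]reprK !piE.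
have e12 : ~~ odd (fdim (repr p.1) * fdim (repr p.2)) by rewrite oddM (negPf e1).
split; first by rewrite /fdim /= oddD (negPf e12).
rewrite /fmx /= signed_disc_osum // -(mulr1 1); apply: same_sqclassM dr.
by apply: signed_disc_tens => //; apply: nd.
Qed.

(** The discriminant is well defined on the even part of W(k) / I^2. *)
Lemma signed_disc_modI2 (q r : ndform k) : ~~ odd (fdim r) ->
  modI2 (\pi_(Witt k) q) = modI2 (\pi_(Witt k) r) ->
  same_sqclass (signed_disc (fmx q)) (signed_disc (fmx r)).
Proof.
move=> er /eqP; rewrite /modI2 -Quotient.idealrBE.
move=> /fundI2_repr_signed_disc[t Et [et dt]].
have E : \pi_(Witt k) q = \pi_(Witt k) (Defs.formD r t).
  by rewrite pi_wittD -Et -[wittD _ _]/(_ + _) addrC subrK.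
have := witt_sym (witt_pi E) => /signed_disc_witt h.
have /h/same_sqclass_sym {}h : ~~ odd (fdim (Defs.formD r t)).
  by rewrite oddD (negPf er).
apply: same_sqclass_trans h _; rewrite /fmx /= signed_disc_osum //.
rewrite -[X in same_sqclass _ X]mulr1; apply: same_sqclassM dt.
apply: same_sqclass_refl.
Qed.

End Forms.

(** * Even-rank forms modulo I^2 are determined by their discriminant *)
Section Disc.
Variable k : fieldType.

Lemma modI2D (x y : Witt k) : modI2 (x + y) = modI2 x + modI2 y.
Proof. exact: raddfD. Qed.

Lemma modI2N (x : Witt k) : modI2 (- x) = - modI2 x.
Proof. exact: raddfN. Qed.

Lemma modI21 : modI2 1 = 1 :> WittModI2 k.
Proof. exact: (rmorph1 (\pi_(WittModI2 k))). Qed.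

Lemma modI2_eq0 (x : Witt k) : x \in @fundI2 k -> modI2 x = 0.
Proof.
rewrite -[x in x \in _]subr0 Quotient.idealrBE => /eqP E.
by rewrite /modI2 E; apply: (raddf0 (\pi_(WittModI2 k))).
Qed.

Lemma line_sym (a : k) : a%:M \in @symform k 1.
Proof. by apply/symformP; rewrite tr_scalar_mx. Qed.

Definition line_form (a : k) : symmx k 1 := SymMx (line_sym a).

Lemma nondeg_line (a : k) : a != 0 -> nondeg (a%:M : 'M[k]_1).
Proof.
by move=> a0; apply/nondegP; rewrite tr_scalar_mx unitmxE det_scalar1 unitfE.
Qed.

Lemma witt_line (a : k) (a0 : a != 0) :
  witt_class (line_form a) = \pi_(Witt k) (NdForm (nondeg_line a0)).
Proof. exact: witt_class_nondeg. Qed.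

Lemma witt_lineM (a b : k) : a != 0 -> b != 0 ->
  witt_class (line_form (a * b))
  = witt_class (line_form a) * witt_class (line_form b).
Proof.
move=> a0 b0; rewrite (witt_line a0) (witt_line b0) (witt_line (mulf_neq0 a0 b0)).
rewrite -[RHS]pi_wittM; apply: pi_isom; apply: isom_sym; rewrite /fmx /=.
rewrite tens_scalar_mx -scale_scalar_mx; exact: isom_cast.
Qed.

Lemma witt_lineN (a : k) : a != 0 ->
  witt_class (line_form (- a)) = - witt_class (line_form a).
Proof.
move=> a0; have na0 : - a != 0 by rewrite oppr_eq0.
rewrite (witt_line a0) (witt_line na0) -[RHS]pi_wittN; apply: pi_isom.
by rewrite /fmx /= -scalemx1 scaleNr scalemx1; apply: isom_refl.
Qed.

Lemma witt_line1 : witt_class (line_form 1) = 1.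
Proof.
rewrite (witt_line (oner_neq0 _)) -[RHS]/(witt1 k) piE.
by apply: pi_isom; apply: isom_refl.
Qed.

Lemma witt_line_sqclass (a b : k) : b != 0 -> same_sqclass a b ->
  witt_class (line_form a) = witt_class (line_form b).
Proof.
move=> b0 [c c0 ->].
have a0 : b * c ^+ 2 != 0 by rewrite mulf_neq0 ?expf_neq0.
rewrite (witt_line a0) (witt_line b0); apply: pi_isom; rewrite /fmx /=.
exists c%:M, c^-1%:M; rewrite -!scalar_mxM mulfV // mulVf //; split=> //.
by rewrite tr_scalar_mx -!scalar_mxM mulrAC mulrC.
Qed.

(** The class of <a, -1>, which is the element of I / I^2 attached to the
    square class of a. *)
Definition disc_class (a : k) : WittModI2 k := modI2 (witt_class (line_form a)) - 1.

Lemma disc_class1 : disc_class 1 = 0.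
Proof. by rewrite /disc_class witt_line1 modI21 subrr. Qed.

(** This is the expansion of (1 - <a>) (1 - <b>), an element of I^2. *)
Lemma disc_classM (a b : k) : a != 0 -> b != 0 ->
  disc_class (a * b) = disc_class a + disc_class b.
Proof.
move=> a0 b0; have I1 c : c != 0 -> 1 - witt_class (line_form c) \in @fundI k.
  have wB (x y : Witt k) : wrank (x - y) = wrank x - wrank y by exact: rmorphB.
  by move=> c0; rewrite inE wB rmorph1 (witt_line c0) wrank_pi subrr.
have /modI2_eq0 :
    (1 - witt_class (line_form a)) * (1 - witt_class (line_form b)) \in @fundI2 k.
  apply/asboolP; exists [:: (1 - witt_class (line_form a),
                               1 - witt_class (line_form b))].
  by rewrite /= !I1 // big_seq1.
rewrite mulrBl mul1r mulrBr mulr1 opprB -witt_lineM //.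
rewrite !(modI2D, modI2N) modI21 /disc_class.
move=> E; apply/eqP; rewrite -subr_eq0 -{}E.
move: (modI2 _) (modI2 _) (modI2 _) => x y z.
by apply/eqP; ring.
Qed.

Lemma disc_class_sqclass (a b : k) : b != 0 -> same_sqclass a b ->
  disc_class a = disc_class b.
Proof. by move=> b0 ab; rewrite /disc_class (witt_line_sqclass b0 ab). Qed.

Lemma disc_classX (a : k) n : a != 0 -> disc_class (a ^+ n) = disc_class a *+ n.
Proof.
move=> a0; elim: n => [|n IH]; first by rewrite expr0 disc_class1.
by rewrite exprS disc_classM ?expf_neq0 // IH mulrS.
Qed.

(** Since <-1> = - <1>, the class is -2; it is also equal to its opposite, as
    (-1)(-1) = 1. *)
Lemma disc_classN1 : disc_class (-1) = 2%:R.
Proof.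
have nz : -1 != 0 :> k by rewrite oppr_eq0 oner_eq0.
have := disc_classM nz nz; rewrite mulrNN mulr1 disc_class1 => /esym/eqP.
rewrite addr_eq0 => /eqP ->.
rewrite /disc_class witt_lineN ?oner_neq0 // witt_line1 modI2N modI21.
by rewrite -opprD opprK.
Qed.

Hypothesis char_neq2 : 2%N \notin [pchar k].

Lemma two_neq0 : 2%:R != 0 :> k.
Proof. by move: char_neq2; rewrite inE /=. Qed.

(** Polarization: if both diagonal entries vanish, the sum of two basis vectors
    takes the value 2 A_ij. *)
Lemma exists_anisotropic n (A : 'M[k]_n) : A^T = A -> A != 0 ->
  exists v : 'rV_n, (v *m A *m v^T) 0 0 != 0.
Proof.
have bil i j : ((delta_mx 0 i : 'rV_n) *m A *m (delta_mx 0 j : 'rV_n)^T) 0 0 = A i j.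
  by rewrite trmx_delta -rowE -colE !mxE.
move=> sA /matrix0Pn[i [j Aij]].
have [Aii|Aii] := eqVneq (A i i) 0; last by exists (delta_mx 0 i); rewrite bil.
have [Ajj|Ajj] := eqVneq (A j j) 0; last by exists (delta_mx 0 j); rewrite bil.
exists (delta_mx 0 i + delta_mx 0 j).
rewrite linearD /= mulmxDr !mulmxDl !mxE.
move: (bil i i) (bil i j) (bil j i) (bil j j).
rewrite !mxE => -> -> -> ->; rewrite Aii Ajj addr0 add0r.
have -> : A j i = A i j by rewrite -[A in LHS]sA mxE.
by rewrite -mulr2n -mulr_natl mulf_neq0 ?two_neq0.
Qed.

(** The scalar c is there because Gaussian elimination returns a basis whose
    first vector is only proportional to v. *)
Lemma extend_to_basis n (v : 'rV[k]_n.+1) : v != 0 ->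
  exists2 P : 'M[k]_n.+1, P \in unitmx &
    exists c : k, v = c *: row 0 P.
Proof.
move=> v0; exists (row_ebase v); first exact: row_ebase_unit.
exists (col_ebase v 0 0).
rewrite -{1}(mulmx_ebase v) {1}[col_ebase v]mx11_scalar mul_scalar_mx -scalemxAl.
congr (_ *: _); rewrite rowE; congr (_ *m _).
have -> : \rank v = 1 by rewrite rank_rV v0.
by apply/matrixP => i j; rewrite !ord1 !mxE /= andbT; case: j => -[].
Qed.

(** One step of the Gram-Schmidt diagonalization: B is the Schur complement of
    an anisotropic vector. *)
Lemma split_line n (A : 'M[k]_n.+1) : nondeg A ->
  exists a (B : 'M[k]_n), [/\ a != 0, nondeg B & isometric A (osum (a%:M : 'M_1) B)].
Proof.
move=> ndA; have [sA uA] := nondegP _ ndA.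
have [|v vAv] := @exists_anisotropic _ A sA.
  by apply: contraTneq uA => ->; rewrite unitmxE det0 unitr0.
have v0 : v != 0 by apply: contraNneq vAv => ->; rewrite !mul0mx mxE.
have [P uP [c vE]] := extend_to_basis v0.
pose C : 'M_(1 + n) := P *m A *m P^T.
have sC : C^T = C by rewrite /C !trmx_mul trmxK sA mulmxA.
pose a := C 0 0.
have a0 : a != 0.
  apply: contraNneq vAv => a0; rewrite vE linearZ /=.
  rewrite -!(scalemxAl, scalemxAr) mxE [X in _ * X]mxE.
  suff -> : (row 0 P *m A *m (row 0 P)^T) 0 0 = C 0 0 by rewrite [C 0 0]a0 !mulr0.
  by rewrite tr_row colE mulmxA -colE -!row_mul [LHS]mxE mxE.
have CE : C = block_mx a%:M (ursubmx C) (ursubmx C)^T (drsubmx C).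
  rewrite -[C in LHS]submxK; congr block_mx; last by rewrite trmx_ursub sC.
  rewrite [LHS]mx11_scalar; congr _%:M; rewrite mxE mxE.
  by congr (C _ _); apply: val_inj.
pose U : 'M_(1 + n) := block_mx 1%:M 0 (- a^-1 *: (ursubmx C)^T) 1%:M.
pose V : 'M_(1 + n) := block_mx 1%:M 0 (a^-1 *: (ursubmx C)^T) 1%:M.
pose B := drsubmx C - a^-1 *: ((ursubmx C)^T *m ursubmx C).
have iCB : isometric C (osum (a%:M : 'M_1) B).
  apply: isom_sym; exists U, V; split.
  - rewrite mulmx_block !(mulmx0, mul0mx, addr0, add0r, mulmx1, mul1mx).
    by rewrite -scalerDl addNr scale0r -scalar_mx_block.
  - rewrite mulmx_block !(mulmx0, mul0mx, addr0, add0r, mulmx1, mul1mx).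
    by rewrite -scalerDl addrN scale0r -scalar_mx_block.
  rewrite {1}CE tr_block_mx trmx0 !trmx1 !mulmx_block.
  rewrite !(mulmx0, mul0mx, addr0, add0r, mulmx1, mul1mx).
  have -> : - a^-1 *: (ursubmx C)^T *m a%:M + (ursubmx C)^T = 0.
    by rewrite mul_mx_scalar scalerA mulrN divff // scaleN1r addNr.
  rewrite linearZ /= trmxK mul_scalar_mx scalerA mulrN divff // scaleN1r addNr.
  by rewrite mul0mx add0r /osum /B addrC scaleNr mulNmx scalemxAl.
have iAC : isometric A C.
  apply: isom_sym; exists P, (invmx P); by rewrite mulmxV // mulVmx.
exists a, B; split=> //; last exact: isom_trans iAC iCB.
have /nondegP[sD uD] := isometric_nondeg (isom_sym (isom_trans iAC iCB)) ndA.
move: sD uD; rewrite /osum tr_block_mx => /eq_block_mx[_ _ _ sB].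
by rewrite unitmxE det_ublock unitrM => /andP[_ uB]; apply/nondegP.
Qed.

(** If A is isometric to <a_1, ..., a_n>, then its class is the sum of the
    1 + disc_class a_i, and disc_class turns products into sums. *)
Lemma modI2_disc n (A : 'M[k]_n) (ndA : nondeg A) :
  modI2 (\pi_(Witt k) (NdForm ndA)) = n%:R + disc_class (\det A).
Proof.
have det0 m (D : 'M[k]_m) : nondeg D -> \det D != 0.
  by move=> /nondegP[_]; rewrite unitmxE unitfE.
elim: n A ndA => [|n IH] A ndA.
  rewrite det_mx00 disc_class1 addr0 -[0%:R](raddf0 (@modI2 k)).
  congr modI2; rewrite -[RHS]/(witt0 k) piE; apply: pi_isom.
  by rewrite /fmx /= [A]flatmx0; apply: isom_refl.
have [a [B [a0 ndB iAB]]] := split_line ndA.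
have -> : \pi_(Witt k) (NdForm ndA)
       = witt_class (line_form a) + \pi_(Witt k) (NdForm ndB).
  by rewrite (witt_line a0) -[RHS]pi_wittD; apply: pi_isom.
have aB0 : a * \det B != 0 by rewrite mulf_neq0 ?det0.
have -> : disc_class (\det A) = disc_class (a * \det B).
  apply: disc_class_sqclass => //; have := det_isometric iAB.
  by rewrite [\det (osum _ _)]det_ublock det_scalar1.
rewrite modI2D IH.
have -> : modI2 (witt_class (line_form a)) = 1 + disc_class a.
  by rewrite /disc_class addrC subrK.
by rewrite disc_classM ?det0 // addrACA -natr1 [1 + _]addrC.
Qed.

(** With n = 2m, the constant n equals disc_class ((-1)^m) because
    disc_class (-1) = 2; this is exactly the sign that turns the determinant
    into the signed discriminant. *)
Lemma modI2_signed_disc (q r : ndform k) : ~~ odd (fdim q) -> ~~ odd (fdim r) ->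
  same_sqclass (signed_disc (fmx q)) (signed_disc (fmx r)) ->
  modI2 (\pi_(Witt k) q) = modI2 (\pi_(Witt k) r).
Proof.
have det0 (s : ndform k) : \det (fmx s) != 0 by rewrite -unitfE -unitmxE fmx_unit.
have N10 n : (-1) ^+ n != 0 :> k by rewrite expf_neq0 // oppr_eq0 oner_eq0.
have signed_disc0 (s : ndform k) : signed_disc (fmx s) != 0 by rewrite mulf_neq0.
suff E (s : ndform k) : ~~ odd (fdim s) ->
    modI2 (\pi_(Witt k) s) = disc_class (signed_disc (fmx s)).
  by move=> eq er qr; rewrite !E //; apply: disc_class_sqclass.
case: s => n [A ndA] /= en; have em : n = n./2.*2 by rewrite even_halfK.
rewrite (modI2_disc ndA) /fmx /= (signed_disc_double _ em).
rewrite disc_classM ?(det0 (NdForm ndA)) //.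
rewrite disc_classX ?oppr_eq0 ?oner_eq0 // disc_classN1.
by congr (_ + _); rewrite {1}em -mul2n natrM mulr_natr.
Qed.

End Disc.

(** * Elimination in block tridiagonal matrices *)
Section Tri.
Variables (k : fieldType) (g : nat).

(** The shape g + (g + ...) makes the block recursion definitional, whereas the
    index type of an iterated block matrix only reduces to it up to a cast. *)
Fixpoint block_dim n : nat := if n is n'.+1 then (g + block_dim n')%N else 0%N.

(** The off-diagonal part (1 0 ... 0) of the first block row. *)
Definition coupling n : 'M[k]_(g, block_dim n) :=
  if n is n'.+1 then row_mx 1%:M 0 else 0.

Fixpoint tridiag n (d : nat -> 'M[k]_g) : 'M[k]_(block_dim n) :=
  if n is n'.+1 then
    block_mx (d 0) (coupling n') (coupling n')^T (tridiag n' (fun i => d i.+1))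
  else 0.

Lemma castmx_row_recl m N M M' (A : 'M[k]_(m, g)) (B : 'M[k]_(m, M))
    (e : (g + M = N)%N) (E : N = (g + M')%N) (f : M = M') :
  castmx (erefl, E) (castmx (erefl, e) (row_mx A B))
  = row_mx A (castmx (erefl, f) B).
Proof. by subst M' N; rewrite (eq_irrelevance E erefl) !castmx_id. Qed.

Lemma castmx_block_recl N M M' (A : 'M[k]_g) (B : 'M[k]_(g, M)) C (D : 'M[k]_M)
    (e : (g + M = N)%N) (E : N = (g + M')%N) (f : M = M') :
  castmx (E, E) (castmx (e, e) (block_mx A B C D))
  = block_mx A (castmx (erefl, f) B) (castmx (f, erefl) C) (castmx (f, f) D).
Proof. by subst M' N; rewrite (eq_irrelevance E erefl) !castmx_id. Qed.

Lemma block_dimE n : (\sum_(i < n) g = block_dim n)%N.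
Proof. by elim: n => [|n IH]; rewrite ?big_ord0 // big_ord_recl IH. Qed.

Lemma coupling_mxrow n :
  castmx (erefl, block_dimE n) (\mxrow_(j < n) (if j == 0 :> nat then 1%:M else 0))
  = coupling n.
Proof.
case: n => [|n]; first by rewrite [LHS]thinmx0 [RHS]thinmx0.
rewrite mxrow_recl /= (castmx_row_recl _ _ _ _ (block_dimE n)); congr row_mx.
by rewrite mxrow0 castmx_const.
Qed.

Lemma mxblock_tridiag n (d : nat -> 'M[k]_g) :
  castmx (block_dimE n, block_dimE n)
    (\mxblock_(i < n, j < n)
      (if i == j then d i
       else if (j == i.+1 :> nat) || (i == j.+1 :> nat) then 1%:M else 0))
  = tridiag n d.
Proof.
elim: n d => [|n IH] d; first by rewrite [LHS]thinmx0 [RHS]thinmx0.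
rewrite mxblock_recul (castmx_block_recl _ _ _ _ _ _ (block_dimE n)) /=.
congr block_mx.
- by rewrite -coupling_mxrow; congr castmx; apply: eq_mxrow => j; rewrite eqSS orbF.
- rewrite -coupling_mxrow trmx_cast tr_mxrow; congr castmx; apply: eq_mxcol => j.
  rewrite eqSS; case: ifP; rewrite ?trmx1 ?trmx0 //.
- by rewrite -IH; congr castmx; apply: eq_mxblock => i j; rewrite (inj_eq lift_inj).
Qed.

Lemma trmx_tridiag n d : (forall i, (d i)^T = d i) -> (tridiag n d)^T = tridiag n d.
Proof.
elim: n d => [|n IH] d sd; first by rewrite [LHS]thinmx0 [RHS]thinmx0.
by rewrite /= tr_block_mx trmxK sd IH.
Qed.

(** Elimination of the first variables in a tridiagonal matrix bordered by the
    row (X, Y, 0, ..., 0): subtracting X times the row (1, d_0, 1, 0, ...)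
    leaves the row (0, Y - X d_0, -X, 0, ...), which has the same form. *)
Fixpoint continuant n (d : nat -> 'M[k]_g) (X Y : 'M[k]_g) : 'M[k]_g :=
  if n is n'.+1 then continuant n' (fun i => d i.+1) (Y - X *m d 0) (- X) else X.

(** After the row operation, the first block column has a single nonzero
    block, which is in the second row; moving it up costs a sign (-1)^g. *)
Lemma det_bordered_tridiag n d X Y :
  \det (block_mx X (Y *m coupling n) (coupling n)^T (tridiag n d))
  = (-1) ^+ (g * n) * \det (continuant n d X Y).
Proof.
elim: n d X Y => [|n IH] d X Y.
  by rewrite muln0 mul1r /= mulmx0 trmx0 det_lblock det_mx00 mulr1.
set Z := block_mx (Y - X *m d 0) (- X *m coupling n) (coupling n)^T
                   (tridiag n (fun i => d i.+1)).
have dZ : \det Z = (-1) ^+ (g * n) * \det (continuant n.+1 d X Y) by apply: IH.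
rewrite mulnS exprD -mulrA -dZ /= -/(block_dim n) {IH dZ}.
set T := block_mx (d 0) _ _ _.
set r : 'M[k]_(g, g + block_dim n) := row_mx 1%:M 0.
have rr : r *m r^T = 1%:M.
  by rewrite /r tr_row_mx trmx1 trmx0 mul_row_col mulmx1 mulmx0 addr0.
(* W exchanges the first two block rows, U subtracts X times the second one. *)
pose W := block_mx 0 r r^T (1%:M - r^T *m r).
pose U := block_mx 1%:M (- X *m r) 0 1%:M : 'M_(g + (g + block_dim n)).
set M := block_mx X (Y *m r) r^T T.
have WUM : W *m (U *m M) = block_mx 1%:M (r *m T) 0 Z.
  rewrite /U /M mulmx_block !(mul1mx, mul0mx, add0r) -mulmxA rr mulmx1 subrr.
  rewrite /W mulmx_block !(mulmx0, mul0mx, add0r) rr mulmxBl mul1mx.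
  rewrite -(mulmxA _ r) rr mulmx1 subrr; congr block_mx.
  have rT : r *m T = row_mx (d 0) (coupling n).
    by rewrite /r /T mul_row_block !mul1mx !mul0mx !addr0.
  rewrite mulmxBl mul1mx -!(mulmxA _ r) rT /r !mul_mx_row !mulmx1 !mulmx0.
  rewrite add_row_mx add0r tr_row_mx trmx1 trmx0 !mul_col_row !mul1mx !mul0mx.
  rewrite !mul_col_mx !mul1mx !mul0mx -block_mxEh.
  rewrite /T opp_block_mx !add_block_mx !subrr !addr0 !oppr0 !addr0 !add0r /Z.
  by rewrite mulNmx.
have := congr1 determinant WUM.
rewrite !det_mulmx det_swap_block // !det_ublock !det1 !mul1r => <-.
by rewrite mulrA -exprD addnn -signr_odd odd_double mul1r.
Qed.

(** The coefficients of R are those used in the successive row operations: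
    when the last remainder vanishes, the border is a combination of the rows
    of the matrix. *)
Lemma tridiag_left_kernel n d X Y : continuant n d X Y = 0 ->
  exists R : 'M_(g, block_dim n),
    X + R *m (coupling n)^T = 0 /\ Y *m coupling n + R *m tridiag n d = 0.
Proof.
elim: n d X Y => [|n IH] d X Y /=.
  by move=> ->; exists 0; rewrite mul0mx addr0 mulmx0 mul0mx addr0.
move=> /IH[R [RX RY]]; exists (row_mx (- X) R).
rewrite tr_row_mx trmx1 trmx0 mul_row_col mulmx1 mulmx0 addr0 subrr; split=> //.
rewrite mul_mx_row mulmx1 mulmx0 mul_row_block add_row_mx add0r RY.
by rewrite mulNmx addrA RX row_mx0.
Qed.

(** The product E(q_0) E(q_1) ... where b is the parity of the first index. *)
Fixpoint alt_elem_mx n (b : bool) (q : nat -> 'M[k]_g) : 'M[k]_(g + g) :=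
  if n is n'.+1 then elem_mx b (q 0) *m alt_elem_mx n' (~~ b) (fun i => q i.+1)
  else 1%:M.

Definition alt_diag (b : bool) (q : nat -> 'M[k]_g) i : 'M[k]_g :=
  (-1) ^+ (b (+) odd i) *: q i.

Lemma eq_continuant n d d' X Y : d =1 d' -> continuant n d X Y = continuant n d' X Y.
Proof. by move=> /funext->. Qed.

Lemma alt_diag_shift b q i : alt_diag b q i.+1 = alt_diag (~~ b) (fun i => q i.+1) i.
Proof. by rewrite /alt_diag /= addbN addNb. Qed.

Lemma alt_diag0 b q : alt_diag b q 0 = (-1) ^+ b *: q 0.
Proof. by rewrite /alt_diag addbF. Qed.

(** Right multiplication of a block row (A B) by E(q) adds B q to A or A q to B,
    according to the parity, and this is one step of the elimination.  The
    pair (X, Y) is (B, -A) before an even index and (A, B) before an odd one,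
    up to a sign s which changes at each even index; hence the exponent, which
    counts the even indices. *)
Lemma continuant_alt_elem_mx n b q (s : k) (A B : 'M[k]_g) :
  let r := row_mx A B *m alt_elem_mx n b q in
  continuant n (alt_diag b q) (s *: if b then A else B) (s *: if b then B else - A)
  = (s * (-1) ^+ (n + ~~ b)./2) *: (if b (+) odd n then lsubmx r else rsubmx r).
Proof.
elim: n b q s A B => [|n IH] b q s A B /=.
  by rewrite mulmx1 addbF; case: b; rewrite /= mulr1 ?row_mxKl ?row_mxKr.
rewrite (eq_continuant _ _ _ (alt_diag_shift b q)) mulmxA /elem_mx alt_diag0.
case: b => /=; rewrite mul_row_block !mulmx1 !mulmx0 ?addr0 ?add0r.
  rewrite expr1 scaleN1r mulmxN opprK -scalemxAl -scalerDr -scalerN.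
  by rewrite negbK (IH false) addn1 addn0 addrC.
rewrite expr0 scale1r -scalemxAl -scalerBr -opprD -scalerN !scalerN -!scaleNr.
rewrite (IH true) addn0 addn1 /= exprS.
by rewrite mulN1r mulrN mulNr.
Qed.

(** The elimination started at the row (1 0) computes the upper left block of
    the product; the signs combine to that of the signed discriminant. *)
Lemma signed_disc_truncation m q : ~~ odd m ->
  signed_disc (tridiag m (alt_diag true q)) = \det (ulsubmx (alt_elem_mx m true q)).
Proof.
move=> em.
have := det_bordered_tridiag m (alt_diag true q) 1%:M 0.
rewrite mul0mx det_lblock det1 mul1r => dT.
have bE : block_dim m = (m./2 * g).*2.
  by rewrite doubleMl even_halfK // -block_dimE sum_nat_const card_ord.
rewrite (signed_disc_double _ bE) dT.
have := continuant_alt_elem_mx m true q 1 1%:M 0; rewrite !scale1r => ->.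
rewrite (negPf em) mul1r addn0 /= detZ.
rewrite -[X in row_mx _ _ *m X]submxK mul_row_block !mul1mx !mul0mx !addr0 row_mxKl.
rewrite -[(-1) ^+ (g * m)]signr_odd oddM (negPf em) andbF mul1r mulrA.
by rewrite -exprM -exprD addnn -signr_odd odd_double mul1r.
Qed.

(** Started at the row (0 1), the elimination computes the lower left block of
    the product.  When it vanishes, a combination of the rows with coefficient
    -1 on the first one is zero; using it as first basis vector splits off a
    zero form. *)
Lemma tridiag_split_radical m q : ~~ odd m -> (forall i, (q i)^T = q i) ->
  dlsubmx (alt_elem_mx m.+1 false q) = 0 ->
  isometric (tridiag m.+1 (alt_diag false q))
    (osum (0 : 'M_g) (tridiag m (alt_diag true (fun i => q i.+1)))).
Proof.
move=> em sq dl0.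
have K : continuant m.+1 (alt_diag false q) 1%:M 0 = 0.
  have := continuant_alt_elem_mx m.+1 false q 1 0 1%:M; rewrite !scale1r oppr0 => ->.
  rewrite [false (+) _]em -[X in row_mx _ _ *m X]submxK mul_row_block.
  by rewrite !mul1mx !mul0mx !add0r row_mxKl dl0 scaler0.
have [R [R1 /eqP]] := tridiag_left_kernel K.
rewrite mul0mx add0r /=; set T := tridiag m _; set c := coupling m.
have sT : T^T = T by apply: trmx_tridiag => i; rewrite /alt_diag linearZ /= sq.
move: R1; rewrite -(@hsubmxK _ g g (block_dim m) R) /=.
rewrite tr_row_mx trmx1 trmx0 mul_row_col mulmx1 mulmx0 addr0 addrC.
move=> /eqP; rewrite addr_eq0 => /eqP ->; move: (rsubmx R) => V.
rewrite mul_row_block -row_mx0 => /eqP/eq_row_mx[dV cV].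
have cVt : - c^T + T *m V^T = 0.
  have := congr1 trmx cV; rewrite mulNmx mul1mx linearD /= trmx0 => <-.
  congr (_ + _); last by rewrite trmx_mul sT.
  by apply/matrixP => i j; rewrite !mxE.
(* The matrix of the change of basis is an involution. *)
apply: isom_sym; exists (block_mx (- 1%:M) V 0 1%:M), (block_mx (- 1%:M) V 0 1%:M).
have PP : block_mx (- 1%:M) V 0 1%:M *m block_mx (- 1%:M) V 0 1%:M
          = 1%:M :> 'M_(g + block_dim m).
  rewrite mulmx_block !(mulmx0, mul0mx, addr0, add0r, mulmx1, mul1mx).
  by rewrite !mulNmx !mul1mx opprK addNr -scalar_mx_block.
have tN : (- 1%:M)^T = - 1%:M :> 'M[k]_g by rewrite linearN /= trmx1.
split=> //.
rewrite mulmx_block dV cV !mul0mx !mul1mx !add0r tr_block_mx mulmx_block.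
rewrite tN trmx1 trmx0 !mul0mx !mulmx0 !addr0 !add0r !mulmx1.
by rewrite mulmxN mulmx1 cVt.
Qed.

End Tri.

(** * Sylvester matrices of sequences of type 00 *)
Lemma oddzD (j : int) (n : nat) : oddz (j + n%:Z) = oddz j (+) odd n.
Proof.
rewrite /oddz; case: j => a; first by rewrite -PoszD !absz_nat oddD.
rewrite NegzE addrC abszN absz_nat.
have [le|lt] := leqP a.+1 n.
  by rewrite distnEl // oddB // addbC.
by rewrite distnEr ?oddB // ltnW.
Qed.

Section SturmTri.
Variables (k : fieldType) (g : nat).

Lemma prod_elem n b (q : nat -> symmx k g) :
  Sp_mx (\prod_(i < n) elem (b (+) odd i) (q i))%g = alt_elem_mx n b q.
Proof.
elim: n b q => [|n IH] b q; first by rewrite big_ord0.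
rewrite big_ord_recl /= addbF; congr (_ *m _); rewrite -IH; congr Sp_mx.
by apply: eq_bigr => i _; rewrite /= addbN addNb.
Qed.

Lemma sturm_odd_even (s : sturm k g) i :
  ~~ oddz (sturm_first s) -> sturm_odd s i = odd i.
Proof. by rewrite /sturm_odd oddzD => /negPf->. Qed.

Lemma evalE_sturm (s : sturm k g) : ~~ oddz (sturm_first s) ->
  Sp_mx (evalE (sturm_prod s)) = alt_elem_mx (sturm_len s) false (sturm_map s).
Proof.
move=> es; rewrite -prod_elem /sturm_prod; congr Sp_mx.
have [E1 EM] := evalE_is_monoid_morphism k g.
rewrite (big_morph (@evalE k g) EM E1).
by apply: eq_bigr => i _; rewrite sturm_odd_even // evalE_in.
Qed.

Lemma sylvester_tridiag (s : sturm k g) : ~~ oddz (sturm_first s) ->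
  isometric (sylvester s) (tridiag (sturm_len s) (alt_diag false (sturm_map s))).
Proof.
move=> es; rewrite -mxblock_tridiag; apply: isom_sym.
apply: isom_trans (isom_cast _ _ _) _; rewrite /= /sylvester_mx.
suff -> : \mxblock_(i < sturm_len s, j < sturm_len s)
   (if i == j then (-1) ^+ sturm_odd s i *: (sturm_map s i : 'M[k]_g)
    else if (j == i.+1 :> nat) || (i == j.+1 :> nat) then 1%:M else 0) =
  \mxblock_(i < sturm_len s, j < sturm_len s)
   (if i == j then alt_diag false (sturm_map s) i
    else if (j == i.+1 :> nat) || (i == j.+1 :> nat) then 1%:M else 0).
  exact: isom_refl.
by apply: eq_mxblock => i j; rewrite sturm_odd_even.
Qed.

Lemma type00_len (s : sturm k g) : type00 s -> odd (sturm_len s).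
Proof.
case/andP=> /negPf es /negPf el.
have : oddz (sturm_last s + 1%:Z) = oddz (sturm_first s + (sturm_len s)%:Z).
  by rewrite /sturm_last subrK.
by rewrite !oddzD es el.
Qed.

Hypothesis char_neq2 : 2%N \notin [pchar k].

Lemma nondeg_dform2 (d : k) : d != 0 -> nondeg (dform [:: 1; - d] : 'M_2).
Proof.
move=> d0; apply/nondegP; rewrite tr_diag_mx unitmxE det_diag; split=> //.
by rewrite big_ord_recl big_ord1 !mxE /= mul1r unitfE oppr_eq0.
Qed.

Lemma signed_disc_dform2 (d : k) : signed_disc (dform [:: 1; - d] : 'M_2) = d.
Proof.
rewrite /signed_disc det_diag big_ord_recl big_ord1 !mxE /= mul1r.
by rewrite expr1 mulN1r opprK.
Qed.

(** Deleting the first letter q_0, which is lower triangular, does not change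
    the upper left block, so T has signed discriminant d. *)
Lemma modI2_sylvester (s : sturm k g) (d : k) : type00 s ->
  dlsubmx (Sp_mx (evalE (sturm_prod s))) = 0 ->
  \det (ulsubmx (Sp_mx (evalE (sturm_prod s)))) = d -> d != 0 ->
  modI2 (witt_class (sylvester s)) = modI2 (witt_class (dform [:: 1; - d])).
Proof.
move=> t00; have [es _] := andP t00; have := type00_len t00.
rewrite evalE_sturm //; have := sylvester_tridiag es.
have sq i : (sturm_map s i : 'M[k]_g)^T = sturm_map s i by apply: tr_symmx.
move: (sturm_map s) sq (sylvester s) => q sq.
case: (sturm_len s) => // m S iST /= em dl0 dE d0.
have := tridiag_split_radical em sq dl0 => /(isom_trans iST).
set q' := fun i => _; set T := tridiag m _ => {}iST.
have dT : signed_disc T = d.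
  rewrite signed_disc_truncation // -dE; congr (\det _).
  rewrite /= -[X in _ *m X]submxK mulmx_block !mul1mx !mul0mx !addr0.
  by rewrite block_mxKul.
have bm : ~~ odd (block_dim g m).
  by rewrite -block_dimE sum_nat_const card_ord oddM (negPf em).
have ndT : nondeg T.
  apply/nondegP; split.
    by apply: trmx_tridiag => i; rewrite /alt_diag linearZ /= sq.
  rewrite unitmxE unitfE; apply: contraNneq d0 => T0.
  by rewrite -dT /signed_disc T0 mulr0.
rewrite (witt_class_radical ndT iST) (witt_class_nondeg (nondeg_dform2 d0)).
apply: modI2_signed_disc => //; rewrite /fmx /= dT signed_disc_dform2.
exact: same_sqclass_refl.
Qed.

End SturmTri.

(** * Symmetric matrices generate the general linear group *)
Section SymGen.
Variable k : fieldType.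

Inductive sym_prod n : 'M[k]_n -> Prop :=
| Sym_prod1 (s : 'M[k]_n) of s^T = s & s \in unitmx : sym_prod s
| Sym_prodM (x y : 'M[k]_n) of sym_prod x & sym_prod y : sym_prod (x *m y).

(** P s P^-1 = (P s P^T) (P P^T)^-1, so the symmetric matrices generate a normal
    subgroup. *)
Lemma sym_prod_conj n (P s : 'M[k]_n) :
  P \in unitmx -> s^T = s -> s \in unitmx -> sym_prod (P *m s *m invmx P).
Proof.
move=> uP ss us.
have -> : P *m s *m invmx P = (P *m s *m P^T) *m invmx (P *m P^T).
  apply: (can_inj (mulmxK uP)); rewrite mulmxKV //.
  apply: (can_inj (mulmxK (_ : P^T \in unitmx))); first by rewrite unitmx_tr.
  by rewrite -!mulmxA mulVmx ?mulmx1 // unitmx_mul uP unitmx_tr.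
apply: Sym_prodM; apply: Sym_prod1.
- by rewrite !trmx_mul trmxK ss mulmxA.
- by rewrite !unitmx_mul unitmx_tr uP us.
- by rewrite trmx_inv trmx_mul trmxK.
- by rewrite unitmx_inv unitmx_mul unitmx_tr uP.
Qed.

Lemma sym_prod_unit n (x : 'M[k]_n) : sym_prod x -> x \in unitmx.
Proof. by elim=> // y z _ uy _ uz; rewrite unitmx_mul uy. Qed.

Lemma sym_prod_tr n (x : 'M[k]_n) : sym_prod x -> sym_prod x^T.
Proof.
elim=> [s ss us|y z _ IHy _ IHz]; first by rewrite ss; apply: Sym_prod1.
by rewrite trmx_mul; apply: Sym_prodM.
Qed.

Lemma sym_prod_block n (x : 'M[k]_n) :
  sym_prod x -> sym_prod (block_mx (1%:M : 'M_1) 0 0 x).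
Proof.
elim=> [s ss us|y z _ IHy _ IHz].
  apply: Sym_prod1; first by rewrite tr_block_mx trmx1 !trmx0 ss.
  by rewrite unitmxE det_ublock det1 mul1r -unitmxE.
have -> : block_mx (1%:M : 'M_1) 0 0 (y *m z) =
          block_mx 1%:M 0 0 y *m block_mx 1%:M 0 0 z.
  by rewrite mulmx_block !(mulmx0, mul0mx, addr0, add0r, mulmx1).
exact: Sym_prodM.
Qed.

Hypothesis char_neq2 : 2%N \notin [pchar k].

(** With D = diag(-1, 1), the commutator of D with the shear by v is the shear
    by -2v: D (P D P^-1) has both factors in the normal subgroup generated by
    symmetric matrices.  This is where 2 has to be invertible. *)
Lemma sym_prod_shear n (c : 'cV[k]_n) : sym_prod (block_mx (1%:M : 'M_1) 0 c 1%:M).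
Proof.
have t0 := two_neq0 char_neq2.
pose v := - 2%:R^-1 *: c.
pose P := block_mx (1%:M : 'M_1) 0 v 1%:M.
pose Q := block_mx (1%:M : 'M_1) 0 (- v) 1%:M.
pose D := block_mx (- 1%:M : 'M[k]_1) 0 0 (1%:M : 'M_n).
have PQ : P *m Q = 1%:M.
  rewrite mulmx_block !(mulmx0, mul0mx, addr0, add0r, mulmx1, mul1mx).
  by rewrite addrN -scalar_mx_block.
have [uP uQ] := mulmx1_unit PQ.
have sD : D^T = D by rewrite tr_block_mx !trmx0 trmx1 linearN /= trmx1.
have uD : D \in unitmx.
  rewrite unitmxE det_ublock det1 mulr1 -scaleN1r detZ det1 mulr1.
  by rewrite unitrX // unitrN1.
have -> : block_mx (1%:M : 'M_1) 0 c 1%:M = D *m (P *m D *m invmx P).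
  have -> : invmx P = Q by rewrite -[Q]mul1mx -(mulVmx uP) -mulmxA PQ mulmx1.
  rewrite !mulmx_block !(mulmx0, mul0mx, addr0, add0r, mulmx1, mul1mx).
  rewrite !mulmxN !mulNmx !mulmx1 opprK; congr block_mx.
  rewrite -opprD /v scaleNr -opprD opprK -scalerDl.
  have -> : 2^-1 + 2^-1 = 1 :> k by field.
  by rewrite scale1r.
apply: Sym_prodM; first exact: Sym_prod1.
exact: sym_prod_conj.
Qed.

(** Gaussian elimination: a transposition is symmetric and provides a pivot,
    after which x is a product of shears, a diagonal matrix and a smaller
    block. *)
Lemma unitmx_sym_prod n (x : 'M[k]_n) : x \in unitmx -> sym_prod x.
Proof.
elim: n x => [|n IH] x ux.
  by apply: Sym_prod1 => //; rewrite [LHS]flatmx0 [RHS]flatmx0.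
wlog x00 : x ux / x 0 0 != 0 => [wl|].
  have [i xi] : exists i, x i 0 != 0.
    apply/existsP; apply: contraTT ux => /existsPn x0.
    have c0 : x *m delta_mx 0 (0 : 'I_1) = 0.
      rewrite -colE; apply/matrixP => i j; rewrite !mxE; apply/eqP.
      by rewrite -[_ == _]negbK.
    apply/negP => ux; have := congr1 (mulmx (invmx x)) c0.
    rewrite mulmxA mulVmx // mul1mx mulmx0 => /matrixP/(_ 0 0)/eqP.
    by rewrite !mxE !eqxx oner_eq0.
  pose t : 'M[k]_n.+1 := tperm_mx 0 i.
  have tt : t *m t = 1%:M by rewrite /t /tperm_mx -perm_mxM tperm2 perm_mx1.
  have [ut _] := mulmx1_unit tt.
  rewrite -[x]mul1mx -tt -mulmxA; apply: Sym_prodM.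
    by apply: Sym_prod1 => //; rewrite tr_tperm_mx.
  apply: wl; first by rewrite unitmx_mul ut.
  by rewrite -xrowE mxE tpermL.
pose y : 'M_(1 + n) := x; pose a := x 0 0.
pose c := dlsubmx y; pose r := ursubmx y.
pose D := drsubmx y - a^-1 *: (c *m r).
have yE : y = block_mx 1%:M 0 (a^-1 *: c) 1%:M
    *m (block_mx (a%:M : 'M_1) 0 0 1%:M *m block_mx 1%:M 0 0 D)
    *m block_mx 1%:M (a^-1 *: r) 0 1%:M.
  rewrite !mulmx_block !(mulmx0, mul0mx, addr0, add0r, mulmx1, mul1mx).
  rewrite -!scalemxAl -!scalemxAr !mul_mx_scalar !mul_scalar_mx !scalerA mulVf //.
  rewrite !scale1r -!scalemxAl scalerA divfK // -[LHS]submxK; congr block_mx.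
    by rewrite [LHS]mx11_scalar mxE mxE; congr _%:M; congr (x _ _); apply: val_inj.
  by rewrite /D addrCA addrN addr0.
have uD : D \in unitmx.
  have : y \in unitmx by [].
  rewrite yE !unitmx_mul => /andP[/andP[_ /andP[_]]].
  by rewrite unitmxE det_ublock det1 mul1r -unitmxE.
rewrite -[x]/y yE; apply: Sym_prodM; last first.
  have := sym_prod_tr (sym_prod_shear (a^-1 *: r)^T).
  by rewrite tr_block_mx !trmx1 trmx0 trmxK.
apply: Sym_prodM; first exact: sym_prod_shear.
apply: Sym_prodM; last exact/sym_prod_block/IH.
apply: (@Sym_prod1 (1 + n)).
  by rewrite tr_block_mx !trmx0 trmx1 tr_scalar_mx.
by rewrite unitmxE det_ublock det1 mulr1 det_scalar1 unitfE.
Qed.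

End SymGen.

(** * Lifting the stabilizer to the free product *)
Section Lifts.
Variables (k : fieldType) (g : nat).

Definition liftable (N : 'M[k]_(g + g)) : Prop :=
  exists w : freeS k g, Sp_mx (evalE w) = N.

Lemma liftable_mul N N' : liftable N -> liftable N' -> liftable (N *m N').
Proof.
case=> w <- [w' <-]; exists (w * w')%g.
by rewrite (evalE_is_monoid_morphism k g).2.
Qed.

Lemma liftable_elem b (q : 'M[k]_g) : q^T = q -> liftable (elem_mx b q).
Proof.
by move=> /symformP sq; exists (fp_in b (SymMx sq)); rewrite evalE_in.
Qed.

Definition levi (x : 'M[k]_g) : 'M[k]_(g + g) := block_mx x 0 0 (invmx x^T).

(** The classical expression of a Weyl element of SL_2 by transvections, which
    only needs s to be symmetric and invertible. *)
Lemma liftable_weyl (s : 'M[k]_g) : s^T = s -> s \in unitmx ->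
  liftable (block_mx 0 s (- invmx s) 0).
Proof.
move=> ss us.
have -> : block_mx 0 s (- invmx s) 0
   = elem_mx true s *m elem_mx false (- invmx s) *m elem_mx true s.
  rewrite /elem_mx !mulmx_block !(mulmx0, mul0mx, addr0, add0r, mulmx1, mul1mx).
  by rewrite mulmxN mulmxV // subrr mul0mx mulNmx mulVmx // addNr add0r.
have e1 := liftable_elem true ss.
apply: liftable_mul => //; apply: liftable_mul => //; apply: liftable_elem.
by rewrite linearN /= trmx_inv ss.
Qed.

Hypothesis char_neq2 : 2%N \notin [pchar k].

(** diag(s, s^-1) is the Weyl element of s times the one of -1. *)
Lemma liftable_levi (x : 'M[k]_g) : x \in unitmx -> liftable (levi x).
Proof.
have NN : - 1%:M *m - 1%:M = 1%:M :> 'M[k]_g.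
  by rewrite mulNmx mul1mx opprK.
have [uN _] := mulmx1_unit NN.
move/(unitmx_sym_prod char_neq2); elim=> [s ss us|y z gy IHy gz IHz].
  have -> : levi s = block_mx 0 s (- invmx s) 0
                     *m block_mx 0 (- 1%:M) (- invmx (- 1%:M)) 0.
    have -> : invmx (- 1%:M) = - 1%:M :> 'M[k]_g.
      by rewrite -[LHS]mulmx1 -{2}NN mulKmx.
    rewrite mulmx_block !(mulmx0, mul0mx, addr0, add0r) opprK !mulmx1.
    by rewrite mulmxN mulmx1 opprK /levi ss.
  apply: liftable_mul; first exact: liftable_weyl.
  by apply: liftable_weyl => //; rewrite linearN /= trmx1.
suff -> : levi (y *m z) = levi y *m levi z by apply: liftable_mul.
rewrite /levi mulmx_block !(mulmx0, mul0mx, addr0, add0r); congr block_mx.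
have uy := sym_prod_unit gy; have uz := sym_prod_unit gz.
rewrite -!trmx_inv -trmx_mul; congr trmx.
have uyz : y *m z \in unitmx by rewrite unitmx_mul uy.
by apply: (can_inj (mulKmx uyz)); rewrite mulmxV // -mulmxA mulKVmx // mulmxV.
Qed.

(** The symplectic relation says that the lower right block is x^-T and that
    x^-1 times the upper right block is symmetric. *)
Lemma stab_decomposition (M : Sp k g) : M \in @StabL k g ->
  let x := ulsubmx (Sp_mx M) in
  x \in unitmx /\ exists2 s : 'M[k]_g, s^T = s & Sp_mx M = levi x *m elem_mx true s.
Proof.
move=> /StabLP dl0 x; have /symplecticP := valP M.
have ME : Sp_mx M = block_mx x (ursubmx (Sp_mx M)) 0 (drsubmx (Sp_mx M)).
  by rewrite -[X in X = _]submxK dl0.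
rewrite /= ME; move: (ursubmx _) (drsubmx _) => u d; rewrite /omega.
rewrite tr_block_mx trmx0 !mulmx_block.
rewrite !(mulmx0, mul0mx, addr0, add0r, mulmx1) !mulmxN !mulmx1 !mulNmx.
move=> /eq_block_mx[_ /oppr_inj xd dx ud].
have [uxt _] := mulmx1_unit xd; have ux : x \in unitmx by rewrite -unitmx_tr.
split=> //; exists (d^T *m u).
  by move/eqP: ud; rewrite subr_eq0 trmx_mul trmxK => /eqP.
have dE : d = invmx x^T by rewrite -[d]mul1mx -(mulVmx uxt) -mulmxA xd mulmx1.
rewrite /levi /elem_mx /= mulmx_block !(mulmx0, mul0mx, addr0, add0r, mulmx1).
by rewrite -dE mulmxA (mulmx1C dx) mul1mx.
Qed.

Lemma liftable_stab (M : Sp k g) : M \in @StabL k g -> liftable (Sp_mx M).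
Proof.
case/stab_decomposition=> ux [s ss ->].
by apply: liftable_mul; [apply: liftable_levi | apply: liftable_elem].
Qed.

End Lifts.

(** * Sturm sequences of type 00 represent every word *)
Section FreeProductLetters.
Variable V : zmodType.

Lemma fp_in_mul (b : bool) (a : V) (x : freeprod V) :
  fp_word (fp_mul (fp_in b a) x) = fp_push (b, a) x.
Proof. by rewrite /= fp_cat_push //; apply: valP. Qed.

Lemma fp_inD b (a a' : V) : fp_in b (a + a') = fp_mul (fp_in b a) (fp_in b a').
Proof. by apply: val_inj; rewrite [RHS]fp_in_mul /= fp_push_push. Qed.

Lemma fp_in0 b : fp_in b (0 : V) = fp_one V.
Proof. by apply: val_inj; rewrite /= /fp_push eqxx. Qed.

Lemma fp_ind (P : freeprod V -> Prop) :
  P (fp_one V) -> (forall b a x, P x -> P (fp_mul (fp_in b a) x)) -> forall x, P x.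
Proof.
move=> P1 PM [w rw]; elim: w rw => [|[b a] w IH] rw.
  by rewrite (_ : FreeProd rw = fp_one V) //; apply: val_inj.
have [a0 rw' pw] := fp_reduced_cons rw.
rewrite (_ : FreeProd rw = fp_mul (fp_in b a) (FreeProd rw')); first exact/PM/IH.
by apply: val_inj; rewrite [RHS]fp_in_mul /= pw.
Qed.

End FreeProductLetters.

Section Final.
Variables (k : fieldType) (g : nat).

Fixpoint alt_word (b : bool) (l : seq (symmx k g)) : freeS k g :=
  (if l is q :: l' then (fp_in b q : freeS k g) * alt_word (~~ b) l' else 1)%g.

Lemma sturm_prod0 l : sturm_prod (0, l) = alt_word false l.
Proof.
rewrite /sturm_prod /sturm_len /sturm_odd /sturm_map /=.
transitivity (\prod_(i < size l) (fp_in (false (+) odd i) l`_i : freeS k g))%g.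
  by apply: eq_bigr => i _; rewrite add0r.
elim: l false => [|q l IH] b; first by rewrite big_ord0.
rewrite big_ord_recl /= addbF -IH; congr (_ * _)%g.
by apply: eq_bigr => i _; rewrite /= addbN addNb.
Qed.

(** A zero letter is the identity, so inserting it allows one to prepend a
    letter of either copy while keeping an even starting index. *)
Lemma exists_type00 (w : freeS k g) :
  exists s : sturm k g, type00 s /\ sturm_prod s = w.
Proof.
suff [q [l [el <-]]] : exists q l, ~~ odd (size l) /\ alt_word false (q :: l) = w.
  exists (0, q :: l); rewrite sturm_prod0; split=> //.
  by rewrite /type00 /sturm_last /sturm_len /= add0r -addn1 PoszD addrK.
elim/fp_ind: w => [|b a x [q [l [el <-]]]].
  by exists 0, [::]; split; rewrite //= fp_in0 mulg1.
case: b.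
  exists 0, [:: a, q & l]; split; first by rewrite /= negbK.
  by rewrite /= fp_in0 mul1g.
exists (a + q), l; split=> //.
by rewrite /= fp_inD -mulgA.
Qed.

Hypothesis char_neq2 : 2%N \notin [pchar k].

(** Both arbitrary choices in Phi exist, and the computation for sequences of
    type 00 applies to whichever are made. *)
Lemma Phi_stab (M : Sp k g) : M \in @StabL k g ->
  StabL_proj M \in unitmx /\
  Phi M = modI2 (witt_class (dform [:: 1; - \det (StabL_proj M)])).
Proof.
move=> sM; have [ux _] := stab_decomposition sM; split=> //.
have [w wM] := liftable_stab char_neq2 sM.
rewrite /Phi; set w' := xget 1%g _.
have Ew : evalE w' = M.
  apply: (@xgetPex _ 1%g [set w0 | evalE w0 = M]%classic); exists w.
  exact: val_inj.
rewrite /f00; set s := xget _ _.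
have [t00 Es] : type00 s /\ sturm_prod s = w'.
  exact: (@xgetPex _ _ [set s0 : sturm k g | type00 s0 /\ sturm_prod s0 = w']%classic
    (exists_type00 w')).
apply: modI2_sylvester => //; rewrite ?Es ?Ew //.
  exact/StabLP.
by move: ux; rewrite unitmxE unitfE.
Qed.

End Final.

Theorem proposition5p9 (k : fieldType) (chark : 2%N \notin [pchar k])
    (g : nat) (g_ge1 : (1 <= g)%N) :
  [/\ forall M N : Sp k g, M \in @StabL k g -> N \in @StabL k g ->
        Phi (M * N)%g = Phi M + Phi N,
      forall M : Sp k g, M \in @StabL k g -> IModI2 (Phi M),
      exists phi : 'M[k]_g -> WittModI2 k,
        (forall x y : 'M[k]_g, x \in unitmx -> y \in unitmx ->
           phi (x *m y) = phi x + phi y) /\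
        (forall M : Sp k g, M \in @StabL k g ->
           StabL_proj M \in unitmx /\ Phi M = phi (StabL_proj M))
    & (* explicit formula, and its reading in the group of square classes *)
      forall (M : Sp k g) (x u : 'M[k]_g), x \in unitmx ->
        Sp_mx M = block_mx x u 0 (invmx x^T) ->
        Phi M = modI2 (witt_class (dform [:: 1; - \det x])) /\
        has_disc (Phi M) (\det x)].
Proof.
have PhiE := Phi_stab chark.
pose phi (x : 'M[k]_g) := modI2 (witt_class (dform [:: 1; - \det x])).
have det0 (x : 'M[k]_g) : x \in unitmx -> \det x != 0 by rewrite unitmxE unitfE.
have phiM x y : x \in unitmx -> y \in unitmx -> phi (x *m y) = phi x + phi y.
  move=> /det0 dx /det0 dy.
  have dxy : \det (x *m y) != 0 by rewrite det_mulmx mulf_neq0.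
  rewrite /phi -modI2D (witt_class_nondeg (nondeg_dform2 dx)).
  rewrite (witt_class_nondeg (nondeg_dform2 dy)).
  rewrite (witt_class_nondeg (nondeg_dform2 dxy)) -[_ + _]pi_wittD.
  apply: modI2_signed_disc => //; rewrite /fmx /= signed_disc_osum //.
  rewrite !signed_disc_dform2 det_mulmx.
  exact: same_sqclass_refl.
split.
- move=> M N sM sN; have [ux EM] := PhiE _ M sM; have [uy EN] := PhiE _ N sN.
  have [_ ->] := PhiE _ (M * N)%g (StabLM sM sN).
  rewrite EM EN -phiM // /phi; congr (modI2 (witt_class (dform [:: _; - \det _]))).
  have /StabLP lM := sM; have /StabLP lN := sN.
  rewrite /StabL_proj /= -{1}[Sp_mx M]submxK -{1}[Sp_mx N]submxK mulmx_block.
  by rewrite block_mxKul lN mulmx0 addr0.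
- move=> M sM; have [/det0 dx ->] := PhiE _ M sM.
  exists (witt_class (dform [:: 1; - \det (StabL_proj M)])) => //.
  by rewrite (witt_class_nondeg (nondeg_dform2 dx)) inE wrank_pi.
- by exists phi; split=> // M sM; apply: PhiE.
move=> M x u ux ME.
have sM : M \in @StabL k g by apply/StabLP; rewrite [val M]ME block_mxKdl.
have [_] := PhiE _ M sM; rewrite /StabL_proj [val M]ME block_mxKul => ->; split=> //.
move=> q; rewrite (witt_class_nondeg (nondeg_dform2 (det0 _ ux))).
move/signed_disc_modI2 => /(_ isT).
by rewrite [X in same_sqclass _ X -> _]signed_disc_dform2.
Qed.
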